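(* Let $\mathbf{u}\in\mathcal{V}$. If $D(\mathcal{L})[\mathbf{u}]$ is a symmetric bounded linear map on $\overline{\mathcal{V}}^2\subset L^2(\Omega;\mathbb{R}^d)$ with $\mathrm{Ker}\{D(\mathcal{L})[\mathbf{u}]\}=\{\mathbf{0}\}$, and there is a $\gamma\neq0$ such that $\mathbb{A}^2[\mathbf{u}]\ge\gamma^2\mathbb{I}$, then $D(\mathcal{L})[\mathbf{u}]^{-1}$ exists as a bounded linear map on $\mathcal{V}$ with respect to the $L^\infty(\Omega;\mathbb{R}^d)$ norm.
   Context: Let $d\in\{2,3\}$ and let $\Omega\subset\mathbb{R}^d$ be a bounded domain (connected open set) satisfying the interior cone condition: there are $\lambda>0$, $\theta>0$ such that every $\mathbf{x}\in\Omega$ is the apex of a spherical cone contained in $\Omega$ of radius $\lambda$ and aperture angle $2\theta$ (with axis along some unit vector $\mathbf{e}_{\mathbf{x}}$). Fix $\epsilon>0$ and let $H_\epsilon(\mathbf{x})$ be the ball of radius $\epsilon$ centered at $\mathbf{x}$; $\omega_d$ is the volume of the unit ball of $\mathbb{R}^d$; $\mathbf{e}_{\mathbf{y}-\mathbf{x}}=(\mathbf{y}-\mathbf{x})/|\mathbf{y}-\mathbf{x}|$. $J$ is a non-negative bounded measurable function supported on $[0,1]$ and $J^\epsilon(r)=J(r/\epsilon)$. The function $g:\mathbb{R}\to\mathbb{R}$ is three times continuously differentiable, $g,g',g'',g'''$ are bounded, $g(0)=0$, $g(r)>0$ for $r\ne0$, $g$ is convex on $(r^e,r^c)$ with $r^e<0<r^c$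 and concave outside this interval, has finite limits at $\pm\infty$, and $\max_r|g''(r)|=g''(0)$. The strain is $S(\mathbf{y},\mathbf{x},\mathbf{u})=\frac{\mathbf{u}(\mathbf{y})-\mathbf{u}(\mathbf{x})}{|\mathbf{y}-\mathbf{x}|}\cdot\mathbf{e}_{\mathbf{y}-\mathbf{x}}$. Let $\Pi=\{\mathbf{Q}\mathbf{x}+\mathbf{c}:\mathbf{Q}^T=-\mathbf{Q}\in\mathbb{R}^{d\times d},\ \mathbf{c}\in\mathbb{R}^d\}$, $\mathcal{V}=\{\mathbf{u}\in L^\infty(\Omega;\mathbb{R}^d):\int_\Omega\mathbf{u}\cdot\mathbf{w}\,d\mathbf{x}=0\ \text{for all }\mathbf{w}\in\Pi\}$, and let $\overline{\mathcal{V}}^2$ be the closure of $\mathcal{V}$ in $L^2(\Omega;\mathbb{R}^d)$. The linear operator $D(\mathcal{L})[\mathbf{u}]$ is $$D(\mathcal{L})[\mathbf{u}]\mathbf{w}(\mathbf{x})=-\int_{H_\epsilon(\mathbf{x})\cap\Omega}\frac{J^\epsilon(|\mathbf{y}-\mathbf{x}|)}{\epsilon^{d+1}\omega_d}\,g''\!\left(\sqrt{|\mathbf{y}-\mathbf{x}|}\,S(\mathbf{y},\mathbf{x},\mathbf{u})\right)S(\mathbf{y},\mathbf{x},\mathbf{w})\,\mathbf{e}_{\mathbf{y}-\mathbf{x}}\,d\mathbf{y},$$ which maps $\mathcal{V}$ into $\mathcal{V}$ and $\overline{\mathcal{V}}^2$ into $\overline{\mathcal{V}}^2$; its kernel in the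 hypothesis is the kernel on $\overline{\mathcal{V}}^2$. The stability tensor is $$\mathbb{A}[\mathbf{u}](\mathbf{x})=\int_{H_\epsilon(\mathbf{x})\cap\Omega}\frac{J^\epsilon(|\mathbf{y}-\mathbf{x}|)}{\epsilon^{d+1}\omega_d|\mathbf{y}-\mathbf{x}|}\,g''\!\left(\sqrt{|\mathbf{y}-\mathbf{x}|}\,S(\mathbf{y},\mathbf{x},\mathbf{u})\right)\mathbf{e}_{\mathbf{y}-\mathbf{x}}\otimes\mathbf{e}_{\mathbf{y}-\mathbf{x}}\,d\mathbf{y},$$ and $\mathbb{A}^2[\mathbf{u}]\ge\gamma^2\mathbb{I}$ means $\boldsymbol{\eta}^T\mathbb{A}[\mathbf{u}](\mathbf{x})^2\boldsymbol{\eta}\ge\gamma^2|\boldsymbol{\eta}|^2$ for all $\mathbf{x}\in\Omega$, $\boldsymbol{\eta}\in\mathbb{R}^d$. *)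

(* Defs.v *)
From HB Require Import structures.
From mathcomp Require Import all_boot all_order all_algebra.
From mathcomp Require Import all_classical all_reals all_analysis.

Set Implicit Arguments.
Unset Strict Implicit.
Unset Printing Implicit Defensive.
Import Order.TTheory GRing.Theory Num.Theory.
Import numFieldNormedType.Exports.
Local Open Scope classical_set_scope.
Local Open Scope ring_scope.

Definition mx_measure_display : measure_display -> measure_display.
Proof. exact. Qed.

Section measurable_mx.
Context {d} {T : measurableType d} (m n : nat).

(* product sigma-algebra: the smallest one making all entries measurable *)
Definition mx_measurable : set (set 'M[T]_(m, n)) :=
  <<s [set A | exists ij B, measurable B /\
        A = [set M : 'M[T]_(m, n) | B (M ij.1 ij.2)]] >>.

Let mx_measurable0 : mx_measurable set0.
Proof. exact: sigma_algebra0. Qed.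

Let mx_measurableC A : mx_measurable A -> mx_measurable (~` A).
Proof. exact: sigma_algebraC. Qed.

Let mx_measurable_bigcup (F : _^nat) : (forall i, mx_measurable (F i)) ->
  mx_measurable (\bigcup_i (F i)).
Proof. exact: sigma_algebra_bigcup. Qed.

HB.instance Definition _ := @isMeasurable.Build (mx_measure_display d)
  'M[T]_(m, n) mx_measurable mx_measurable0 mx_measurableC mx_measurable_bigcup.

Lemma measurable_mx_entry (i : 'I_m) (j : 'I_n) :
  measurable_fun [set: 'M[T]_(m, n)] (fun M : 'M[T]_(m, n) => M i j).
Proof.
move=> _ B mB; rewrite setTI; apply: sub_sigma_algebra.
by exists (i, j), B.
Qed.

Lemma measurable_fun_mxP d' (S : measurableType d') (D : set S)
    (f : S -> 'M[T]_(m, n)) : measurable D ->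
  measurable_fun D f <-> forall i j, measurable_fun D (fun x => f x i j).
Proof.
move=> mD; split=> [mf i j|mf].
  exact: (measurableT_comp (measurable_mx_entry i j)).
apply: (@measurability _ _ _ _ D f
  [set A | exists ij B, measurable B /\
     A = [set M : 'M[T]_(m, n) | B (M ij.1 ij.2)]]) => //.
by move=> _ [_ [[i j] [B [mB ->]]] <-]; exact: mf.
Qed.

End measurable_mx.

Section lebesgue_cV.
Context {R : realType}.

Section cons.
Context (n : nat).

Definition cV_cons (p : measurableTypeR R * 'cV[R]_n) : 'cV[R]_n.+1 :=
  col_mx (p.1%:M : 'cV_1) p.2.
Definition cV_uncons (v : 'cV[R]_n.+1) : measurableTypeR R * 'cV[R]_n :=
  (v ord0 ord0, \col_i v (lift ord0 i) ord0).

Lemma cV_cons0 p j : cV_cons p ord0 j = p.1.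
Proof.
by rewrite mxE; case: splitP => [k _|k //]; rewrite mxE !ord1 eqxx.
Qed.

Lemma cV_consS p i j : cV_cons p (lift ord0 i) j = p.2 i j.
Proof.
rewrite mxE; case: splitP => [k /=|k /=]; rewrite /bump/= => ik.
  by have := ltn_ord k; rewrite -ik.
by congr (p.2 _ _); apply/val_inj; case: ik.
Qed.

Lemma cV_consK : cancel cV_cons cV_uncons.
Proof.
move=> [x v]; rewrite /cV_uncons cV_cons0; congr pair.
by apply/colP => i; rewrite mxE cV_consS.
Qed.

Lemma cV_unconsK : cancel cV_uncons cV_cons.
Proof.
move=> v; apply/colP => i; have [k ->|->] := unliftP ord0 i.
  by rewrite cV_consS mxE.
by rewrite cV_cons0.
Qed.

Lemma measurable_cV_cons :
  measurable_fun [set: measurableTypeR R * 'cV[R]_n] cV_cons.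
Proof.
apply/measurable_fun_mxP => // i j; have [k ->|->] := unliftP ord0 i.
  rewrite (_ : (fun _ => _) = (fun v : 'cV[R]_n => v k j) \o snd).
    exact: (measurableT_comp (measurable_mx_entry k j)).
  by apply/funext => p /=; rewrite cV_consS.
rewrite (_ : (fun _ => _) = fst); first exact: measurable_fst.
by apply/funext => p; rewrite cV_cons0.
Qed.

Lemma measurable_cV_uncons : measurable_fun [set: 'cV[R]_n.+1] cV_uncons.
Proof.
apply: measurable_fun_pair; first exact: measurable_mx_entry.
apply/measurable_fun_mxP => // i j.
rewrite (_ : (fun _ => _) = fun v : 'cV[R]_n.+1 => v (lift ord0 i) ord0).
  exact: measurable_mx_entry.
by apply/funext => v; rewrite mxE.
Qed.

Variable mu : {sigma_finite_measure set 'cV[R]_n -> \bar R}.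

Definition cons_measure : set 'cV[R]_n.+1 -> \bar R :=
  pushforward (lebesgue_measure \x mu)%E cV_cons.

Let cons_measure0 : cons_measure set0 = 0%E.
Proof. by rewrite /cons_measure /pushforward preimage_set0 measure0. Qed.

Let cons_measure_ge0 A : (0 <= cons_measure A)%E.
Proof. by rewrite /cons_measure /pushforward; exact: measure_ge0. Qed.

Let cons_measure_sigma_additive : semi_sigma_additive cons_measure.
Proof.
move=> F mF tF mUF; rewrite /cons_measure /pushforward preimage_bigcup.
apply: measure_semi_sigma_additive.
- by move=> k; rewrite -[X in measurable X]setTI; exact: measurable_cV_cons.
- apply/trivIsetP => i j _ _ ij; rewrite -preimage_setI.
  by move/trivIsetP : tF => /(_ _ _ _ _ ij) ->//; rewrite preimage_set0.
- by rewrite -preimage_bigcup -[X in measurable X]setTI;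
    exact: measurable_cV_cons.
Qed.

HB.instance Definition _ := isMeasure.Build _ _ _ cons_measure
  cons_measure0 cons_measure_ge0 cons_measure_sigma_additive.

Let cons_measure_sigma_finite : sigma_finite setT cons_measure.
Proof.
have /sigma_finiteP[F [TF ndF Foo]] := sigma_finiteT (@lebesgue_measure R).
have /sigma_finiteP[G [TG ndG Goo]] := sigma_finiteT mu.
exists (fun k => cV_uncons @^-1` (F k `*` G k)).
  apply/seteqP; split=> // v _.
  have [k _ Fk] : (\bigcup_k F k) (cV_uncons v).1 by rewrite -TF.
  have [l _ Gl] : (\bigcup_k G k) (cV_uncons v).2 by rewrite -TG.
  exists (maxn k l) => //; split.
    by move: Fk; exact/subsetPset/ndF/leq_maxl.
  by move: Gl; exact/subsetPset/ndG/leq_maxr.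
move=> k; have [mF Fk] := Foo k; have [mG Gk] := Goo k; split.
  by rewrite -[X in measurable X]setTI; apply: measurable_cV_uncons => //;
    exact: measurableX.
rewrite /cons_measure /pushforward -comp_preimage.
rewrite (_ : cV_uncons \o cV_cons = id); last first.
  by apply/funext => p /=; rewrite cV_consK.
by rewrite preimage_id product_measure1E// lte_mul_pinfty// ge0_fin_numE.
Qed.

HB.instance Definition _ :=
  Measure_isSigmaFinite.Build _ _ _ cons_measure cons_measure_sigma_finite.

End cons.

(* n-fold product of the one-dimensional Lebesgue measure; it is determined by
   its values on boxes, see lebesgue_cV_box *)
Fixpoint lebesgue_cV (n : nat) : {sigma_finite_measure set 'cV[R]_n -> \bar R} :=
  match n with
  | 0 => \d_(0 : 'cV[R]_0)
  | n'.+1 => cons_measure (lebesgue_cV n')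
  end.

Lemma lebesgue_cV_box n (A : 'I_n -> set (measurableTypeR R)) :
  (forall i, measurable (A i)) ->
  (lebesgue_cV n [set x | forall i, A i (x i ord0)] =
   \prod_(i < n) lebesgue_measure (A i))%E.
Proof.
elim: n A => [|n IHn] A mA.
  by rewrite big_ord0 /= diracE mem_set// => -[].
rewrite big_ord_recl /= /cons_measure /pushforward.
rewrite (_ : _ @^-1` _ = A ord0 `*`
    [set x : 'cV[R]_n | forall i, A (lift ord0 i) (x i ord0)]); last first.
  apply/seteqP; split=> -[x v] /=.
    move=> Av; split=> [|i /=]; first by have := Av ord0; rewrite cV_cons0.
    by have := Av (lift ord0 i); rewrite cV_consS.
  move=> [A0 AS] i; have [k ->|->] := unliftP ord0 i.
    by rewrite cV_consS; exact: AS.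
  by rewrite cV_cons0.
rewrite product_measure1E//; first congr (_ * _)%E.
  by apply: (IHn (fun i => A (lift ord0 i))) => i; exact: mA.
rewrite (_ : [set x | _] = \bigcap_(i in setT)
    [set x : 'cV[R]_n | A (lift ord0 i) (x i ord0)]); last first.
  by apply/seteqP; split=> [x Ax i _|x Ax i]; [exact: Ax|exact: (Ax i)].
apply: fin_bigcap_measurable => // i _.
rewrite -[X in measurable X]setTI.
exact: (@measurable_mx_entry _ (measurableTypeR R)).
Qed.

End lebesgue_cV.

Section euclidean.
Context {R : realType} {d : nat}.
Implicit Types (x y : 'cV[R]_d) (D : set 'cV[R]_d).

Definition edot x y : R := (x^T *m y) 0 0.

(* the library norm `|x| on matrices is the sup norm, hence this one *)
Definition enorm x : R := Num.sqrt (edot x x).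

Definition eball x (r : R) : set 'cV[R]_d := [set y | enorm (y - x) < r].

(* equal to 0 when y = x, since 0^-1 = 0; this only affects a null set *)
Definition edir y x : 'cV[R]_d := (enorm (y - x))^-1 *: (y - x).

Definition mx_integral m n D (F : 'cV[R]_d -> 'M[R]_(m, n)) : 'M[R]_(m, n) :=
  \matrix_(i, j) \int[lebesgue_cV d]_(y in D) F y i j.

(* the bound theta <= pi keeps cos monotone on the admissible half-apertures,
   so that the condition on y bounds the angle between y - x and the axis e *)
Definition interior_cone_condition (Omega : set 'cV[R]_d) : Prop :=
  exists lambda theta : R, [/\ 0 < lambda, 0 < theta <= pi &
    forall x, Omega x -> exists2 e, enorm e = 1 &
      [set y | enorm (y - x) < lambda /\
               enorm (y - x) * cos theta <= edot (y - x) e] `<=` Omega].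

End euclidean.

Section vector_fields.
Context {R : realType} {d : nat} (Omega : set 'cV[R]_d).
Implicit Types (u v w : 'cV[R]_d -> 'cV[R]_d) (p : \bar R).
Implicit Types (V : set ('cV[R]_d -> 'cV[R]_d)).

(* Elements of L^p(Omega; R^d) are represented by functions that are measurable
   on Omega; two of them are identified when equal almost everywhere on Omega. *)
Definition ae_eq_on u v : Prop := u = v %[ae lebesgue_cV d in Omega].

Definition vLnorm p u : \bar R :=
  'N[lebesgue_cV d]_p [EFin \o ((enorm \o u) \_ Omega)]%E.

Definition vLfun p : set ('cV[R]_d -> 'cV[R]_d) :=
  [set u | measurable_fun Omega u /\ (vLnorm p u < +oo)%E].

Definition vdot u v : R := \int[lebesgue_cV d]_(x in Omega) edot (u x) (v x).

Definition rigid_motion : set ('cV[R]_d -> 'cV[R]_d) :=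
  [set w | exists (Q : 'M[R]_d) (c : 'cV[R]_d),
     Q^T = - Q /\ w = (fun x => Q *m x + c)].

Definition calV : set ('cV[R]_d -> 'cV[R]_d) :=
  [set u | vLfun +oo%E u /\ forall w, rigid_motion w -> vdot u w = 0].

Definition calV_closure2 : set ('cV[R]_d -> 'cV[R]_d) :=
  [set u | vLfun 2%:E u /\ forall delta : R, 0 < delta ->
     exists2 v, calV v & (vLnorm 2%:E (u - v)%R < delta%:E)%E].

(* Linearity and boundedness hold up to a.e. equality; together they make T
   compatible with it, as ||T (f - g)||_p <= C ||f - g||_p. *)
Definition bounded_linear_map p V
    (T : ('cV[R]_d -> 'cV[R]_d) -> ('cV[R]_d -> 'cV[R]_d)) : Prop :=
  [/\ forall f, V f -> V (T f),
      forall (a : R) f g, V f -> V g ->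
        ae_eq_on (T (a *: f + g)) (a *: T f + T g) &
      exists C : R, forall f, V f -> (vLnorm p (T f) <= C%:E * vLnorm p f)%E].

Definition symmetric_map V
    (T : ('cV[R]_d -> 'cV[R]_d) -> ('cV[R]_d -> 'cV[R]_d)) : Prop :=
  forall f g, V f -> V g -> vdot (T f) g = vdot f (T g).

Definition trivial_kernel V
    (T : ('cV[R]_d -> 'cV[R]_d) -> ('cV[R]_d -> 'cV[R]_d)) : Prop :=
  forall f, V f -> ae_eq_on (T f) 0 -> ae_eq_on f 0.

Definition has_bounded_inverse p V
    (T : ('cV[R]_d -> 'cV[R]_d) -> ('cV[R]_d -> 'cV[R]_d)) : Prop :=
  (forall f, V f -> V (T f)) /\
  exists2 S, bounded_linear_map p V S &
    forall f, V f -> ae_eq_on (S (T f)) f /\ ae_eq_on (T (S f)) f.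

End vector_fields.

Section peridynamics.
Context {R : realType}.

Definition influence_function (J : R -> R) : Prop :=
  [/\ measurable_fun setT J, [bounded J r | r in setT],
      forall r, 0 <= J r & forall r, ~ (0 <= r <= 1) -> J r = 0].

(* last clause: max |g''| = g''(0) *)
Definition potential (g : R -> R) : Prop :=
  [/\ (forall k x, (k < 3)%N -> derivable (derive1n k g) x 1) /\
      continuous (derive1n 3 g),
      forall k, (k <= 3)%N -> [bounded derive1n k g r | r in setT],
      g 0 = 0 /\ (forall r, r != 0 -> 0 < g r),
      exists re rc : R, [/\ re < 0, 0 < rc,
        convex_function (`]re, rc[%classic : set R) g,
        convex_function (`]-oo, re]%classic : set R) (\- g) &
        convex_function (`[rc, +oo[%classic : set R) (\- g)] &
      [/\ cvg (g r @[r --> +oo]), cvg (g r @[r --> -oo]) &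
          forall r, `|derive1n 2 g r| <= derive1n 2 g 0]].

Context {d : nat} (Omega : set 'cV[R]_d) (eps : R) (J g : R -> R).
Implicit Types (u w : 'cV[R]_d -> 'cV[R]_d) (x y : 'cV[R]_d).

Definition unit_ball_volume : R := fine (lebesgue_cV d (eball 0 1)).

Definition strain u y x : R :=
  edot ((enorm (y - x))^-1 *: (u y - u x)) (edir y x).

Definition weight y x : R :=
  J (enorm (y - x) / eps) / (eps ^+ d.+1 * unit_ball_volume).

Definition bond_stiffness u y x : R :=
  derive1n 2 g (Num.sqrt (enorm (y - x)) * strain u y x).

Definition linearization u w x : 'cV[R]_d :=
  - mx_integral (eball x eps `&` Omega) (fun y =>
      (weight y x * bond_stiffness u y x * strain w y x) *: edir y x).

Definition stability_tensor u x : 'M[R]_d :=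
  mx_integral (eball x eps `&` Omega) (fun y =>
    (weight y x / enorm (y - x) * bond_stiffness u y x) *:
      (edir y x *m (edir y x)^T)).

Definition stability_sqr_ge u (gamma : R) : Prop :=
  forall x eta, Omega x ->
    gamma ^+ 2 * enorm eta ^+ 2 <=
      edot eta (stability_tensor u x *m stability_tensor u x *m eta).

End peridynamics.

(* Main.v *)
Require Import Defs.
From HB Require Import structures.
From mathcomp Require Import all_boot all_order all_algebra.
From mathcomp Require Import all_classical all_reals all_analysis.
From mathcomp Require Import measurable_realfun ess_sup_inf ring lra.
Import Order.TTheory GRing.Theory Num.Theory.
Import numFieldNormedType.Exports.
Local Open Scope classical_set_scope.
Local Open Scope ring_scope.

(** Write x, y for points of Omega, e for the unit direction of y - x, and
k(x,y) = c(x,y) e e^T for the matrix kernel of the linearization L, so that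
L f(x) = int k(x,y) (f(x) - f(y)) dy = A(x) f(x) - (K f)(x), where A is the
stability tensor and K the integral operator with kernel k.  The kernel k is
symmetric and |k(x,y)| is at most a constant over |x - y|.

The tensor A(x) is symmetric and A^2 >= gamma^2, hence A(x) is invertible with
inverse bounded by 1/|gamma|, and L f = b is a Fredholm equation of the second
kind.  To remove the kernel of L, which contains the rigid motions, one solves
instead L f + P f = b, where P f = sum_q <f,p_q> p_q for a finite family (p_q)
spanning the rigid motions.  As L is symmetric and annihilates rigid motions,
L f is always orthogonal to them.  If b is too, then P f is orthogonal to every
p_q, so |P f|^2 = 0, then <P f,f> = sum_q <f,p_q>^2 = 0, so f lies in calV and
L f = b.  With b = 0 this shows that L + P is injective, because L is injective
on calV.

Everything takes place in the space of bounded measurable functions; the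
completeness of L^2 and the compactness of operators are replaced by a
direct argument ([fredholm_alternative]).  The kernel of A^-1 (K - P) is split
into three parts: one concentrated near the diagonal, which is small in the
sense of Schur because 1/|x - y| is integrable in dimension at least 2
([singular_integral]); a finite rank part; and a remainder that is bounded and
small in L^1 of the product.  Such a splitting exists because every bounded
measurable kernel is an L^1 limit of finite rank kernels with the same bound
([finite_rank_approx]).  The remainder maps L^1 to bounded functions, and
bounded functions to small elements of L^1, so together with the part near the
diagonal it contracts a norm mixing the sup norm and the L^1 norm, and a
Neumann series inverts the identity minus these two parts ([neumann]).  What is
left is a finite linear system, whose matrix is invertible by injectivity.

A system of equations is a scalar equation on the product of the space with the
set of components ([fredholm_system]); [bounded_solution] applies it to L + P.
The inverse of L is then chosen separately at each b, and it is linear up to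
null sets because L is injective on calV. *)

Set Implicit Arguments.
Unset Strict Implicit.
Unset Printing Implicit Defensive.

(** * Bounded measurable functions and integral operators *)

Section bounded_measurable.
Context {d} {T : measurableType d} {R : realType}.
Implicit Types (f g : T -> R) (r s : R).

Definition bmeas f r := measurable_fun setT f /\ forall x, `|f x| <= r.

Lemma bmeas_cst c : bmeas (cst c) `|c|.
Proof. by split=> // x; exact: lexx. Qed.

Lemma bmeasD f g r s : bmeas f r -> bmeas g s -> bmeas (fun x => f x + g x) (r + s).
Proof.
move=> [mf fr] [mg gs]; split; first exact: measurable_funD.
by move=> x; rewrite (le_trans (ler_normD _ _))// lerD.
Qed.

Lemma bmeasM f g r s : bmeas f r -> bmeas g s -> bmeas (fun x => f x * g x) (r * s).
Proof.
move=> [mf fr] [mg gs]; split; first exact: measurable_funM.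
by move=> x; rewrite normrM ler_pM.
Qed.

Lemma bmeasZ c f r : bmeas f r -> bmeas (fun x => c * f x) (`|c| * r).
Proof. exact/bmeasM/bmeas_cst. Qed.

Lemma bmeas_sum (I : Type) (s : seq I) (F : I -> T -> R) (B : I -> R) :
  (forall i, bmeas (F i) (B i)) ->
  bmeas (fun x => \sum_(i <- s) F i x) (\sum_(i <- s) B i).
Proof.
move=> FB; split; first by apply: measurable_sum => i; case: (FB i).
move=> x; rewrite (le_trans (ler_norm_sum _ _ _))// ler_sum// => i _.
by case: (FB i).
Qed.

Lemma bmeas_integrable (mu : {finite_measure set T -> \bar R}) f r :
  bmeas f r -> mu.-integrable setT (EFin \o f).
Proof.
move=> [mf fr]; apply: measurable_bounded_integrable => //.
  by rewrite -ge0_fin_numE// fin_num_measure.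
exists r; split; first exact: num_real.
by move=> M rM x _ /=; rewrite (le_trans (fr x))// ltW.
Qed.

End bounded_measurable.

Section integral_operator.
Context {d} {T : measurableType d} {R : realType}.
Variable mu : {finite_measure set T -> \bar R}.
Implicit Types (H G : T * T -> R) (f : T -> R) (m r : R).

Definition kernel_op H f : T -> R := fun x => \int[mu]_y (H (x, y) * f y).

(** The Schur condition: it bounds the operator by m both for the sup norm and
for the L^1 norm. *)
Definition schur H m := [/\ 0 <= m, measurable_fun setT H,
  forall x, (\int[mu]_y `|H (x, y)|%:E <= m%:E)%E &
  forall y, (\int[mu]_x `|H (x, y)|%:E <= m%:E)%E].

Lemma measurable_slice H x : measurable_fun setT H ->
  measurable_fun setT (fun y => H (x, y)).
Proof. by move=> mH; exact: (measurableT_comp mH). Qed.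

Lemma measurable_slice2 H y : measurable_fun setT H ->
  measurable_fun setT (fun x => H (x, y)).
Proof. by move=> mH; apply: (measurableT_comp mH); exact: measurable_pair2. Qed.

Lemma schur_slice H m f r x : schur H m -> bmeas f r ->
  mu.-integrable setT (EFin \o (fun y => H (x, y) * f y)) /\
  (\int[mu]_y `|H (x, y) * f y|%:E <= (m * r)%:E)%E.
Proof.
move=> [_ mH Hm _] [mf fr].
have mHx := measurable_slice x mH.
have r0 : 0 <= r by rewrite (le_trans _ (fr x)).
have mHf : measurable_fun setT (fun y => H (x, y) * f y) by exact: measurable_funM.
have le : (\int[mu]_y `|H (x, y) * f y|%:E <= (m * r)%:E)%E.
  rewrite EFinM muleC; apply: (@le_trans _ _ (\int[mu]_y (r%:E * `|H (x, y)|%:E))%E).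
    apply: ge0_le_integral => //.
    - by apply/measurable_EFinP; exact: measurableT_comp.
    - by apply/measurable_EFinP; apply: measurable_funM => //; exact: measurableT_comp.
    - by move=> y _; rewrite -EFinM lee_fin normrM mulrC ler_pM.
  rewrite ge0_integralZl_EFin//; last first.
    by apply/measurable_EFinP; exact: measurableT_comp.
  by apply: lee_wpmul2l; rewrite ?lee_fin.
split=> //; apply/integrableP; split; first exact/measurable_EFinP.
by rewrite (le_lt_trans le)// ltry.
Qed.

Lemma kernel_op_bound H m f r x : schur H m -> bmeas f r -> `|kernel_op H f x| <= m * r.
Proof.
move=> sH bf; have [int le] := schur_slice x sH bf.
rewrite -lee_fin EFin_normr_Rintegral//; apply: le_trans le.
by apply: le_abse_integral => //; case/integrableP : int.
Qed.

Lemma measurable_kernelM H f : measurable_fun setT H -> measurable_fun setT f ->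
  measurable_fun setT (fun p : T * T => H p * f p.2).
Proof.
by move=> mH mf; apply: measurable_funM => //; exact: measurableT_comp.
Qed.

Lemma measurable_kernel_op H m f r : schur H m -> bmeas f r ->
  measurable_fun setT (kernel_op H f).
Proof.
move=> sH bf; have [_ mH _ _] := sH; have [mf _] := bf.
have mG := measurable_kernelM mH mf.
have iG : (mu \x mu)%E.-integrable setT (EFin \o (fun p : T * T => H p * f p.2)).
  apply/integrable12ltyP; first exact/measurable_EFinP.
  apply: (@le_lt_trans _ _ (\int[mu]_x `|m * r|%:E)%E).
    apply: ge0_le_integral => //=.
    - by move=> x _; exact: integral_ge0.
    - apply: (@measurable_fun_fubini_tonelli_F _ _ _ _ _ mu
        (fun p => (`|H p * f p.2|)%:E)) => //.
      by apply/measurable_EFinP; exact: measurableT_comp.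
    - move=> x _; have [_ le] := schur_slice x sH bf.
      by apply: le_trans le _; rewrite lee_fin ler_norm.
  rewrite integral_cst// lte_mul_pinfty//.
  by rewrite -ge0_fin_numE// fin_num_measure.
exact: (measurableT_comp _ (measurable_fubini_F iG)).
Qed.

(** Tonelli: integrate |H(x,y)| |f(y)| in x first. *)
Lemma le_L1_kernel_op H m f r l : schur H m -> bmeas f r ->
  (\int[mu]_x `|f x|%:E <= l%:E)%E ->
  (\int[mu]_x `|kernel_op H f x|%:E <= (m * l)%:E)%E.
Proof.
move=> sH bf fl; have [m0 mH _ Hm] := sH; have [mf _] := bf.
have mG : measurable_fun setT (fun p : T * T => (`|H p * f p.2|)%:E).
  by apply/measurable_EFinP; apply: measurableT_comp => //; exact: measurable_kernelM.
have mkernel_op := measurable_kernel_op sH bf.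
apply: (@le_trans _ _ (\int[mu]_x \int[mu]_y `|H (x, y) * f y|%:E)%E).
  apply: ge0_le_integral => //.
  - by apply/measurable_EFinP; exact: measurableT_comp.
  - exact: (@measurable_fun_fubini_tonelli_F _ _ _ _ _ mu
        (fun p => (`|H p * f p.2|)%:E)).
  - move=> x _; have [int _] := schur_slice x sH bf.
    rewrite EFin_normr_Rintegral//.
    by apply: le_abse_integral => //; case/integrableP : int.
rewrite (@fubini_tonelli _ _ _ _ _ mu mu (fun p => (`|H p * f p.2|)%:E))//=.
rewrite EFinM.
apply: (@le_trans _ _ (\int[mu]_y (m%:E * `|f y|%:E))%E).
  apply: ge0_le_integral => //=.
  - by move=> y _; exact: integral_ge0.
  - exact: (@measurable_fun_fubini_tonelli_G _ _ _ _ _ mu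
        (fun p => (`|H p * f p.2|)%:E)).
  - by apply/measurable_EFinP; apply: measurable_funM => //; exact: measurableT_comp.
  move=> y _; under eq_integral do rewrite normrM EFinM.
  rewrite ge0_integralZr//.
    by apply: lee_wpmul2r => //; rewrite lee_fin.
  by apply/measurable_EFinP; apply: measurableT_comp => //; exact: measurable_slice2.
rewrite ge0_integralZl_EFin//.
  by apply: lee_wpmul2l => //; rewrite lee_fin.
by apply/measurable_EFinP; exact: measurableT_comp.
Qed.

Lemma kernel_opD H m f g r s c x : schur H m -> bmeas f r -> bmeas g s ->
  kernel_op H (fun y => f y + c * g y) x = kernel_op H f x + c * kernel_op H g x.
Proof.
move=> sH bf bg.
have [intf _] := schur_slice x sH bf.
have [intg _] := schur_slice x sH bg.
rewrite /kernel_op -RintegralZl// -RintegralD//.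
  by apply: eq_Rintegral => y _; rewrite mulrDr mulrCA.
exact: (integrableZl measurableT c intg).
Qed.

Lemma kernel_op_addr H G m n f r x : schur H m -> schur G n -> bmeas f r ->
  kernel_op (fun p => H p + G p) f x = kernel_op H f x + kernel_op G f x.
Proof.
move=> sH sG bf.
have [intf _] := schur_slice x sH bf.
have [intg _] := schur_slice x sG bf.
by rewrite /kernel_op -RintegralD//; apply: eq_Rintegral => y _; rewrite mulrDl.
Qed.

Lemma kernel_op_sum H m (I : Type) (s : seq I) (F : I -> T -> R) (B c : I -> R) x :
  schur H m -> (forall i, bmeas (F i) (B i)) ->
  kernel_op H (fun y => \sum_(i <- s) c i * F i y) x = \sum_(i <- s) c i * kernel_op H (F i) x.
Proof.
move=> sH FB; elim: s => [|i s IHs].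
  rewrite big_nil /kernel_op; under eq_Rintegral do rewrite big_nil mulr0.
  by rewrite Rintegral_cst// mul0r.
rewrite big_cons -IHs addrC.
have bs : bmeas (fun y => \sum_(j <- s) c j * F j y) (\sum_(j <- s) `|c j| * B j).
  by apply: bmeas_sum => j; exact: bmeasZ.
rewrite -(kernel_opD _ _ sH bs (FB i)); congr (kernel_op _ _ _).
by apply/funext => y; rewrite big_cons addrC.
Qed.

End integral_operator.
(** * Approximation by finite rank kernels *)

Lemma le_integral_comb {d} {T : measurableType d} {R : realType}
    (mu : {measure set T -> \bar R}) (f f1 f2 : T -> R) (a b e1 e2 : R) :
  measurable_fun setT f -> measurable_fun setT f1 -> measurable_fun setT f2 ->
  0 <= a -> 0 <= b -> (forall x, `|f x| <= a * `|f1 x| + b * `|f2 x|) ->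
  (\int[mu]_x `|f1 x|%:E <= e1%:E)%E -> (\int[mu]_x `|f2 x|%:E <= e2%:E)%E ->
  (\int[mu]_x `|f x|%:E <= (a * e1 + b * e2)%:E)%E.
Proof.
move=> mf mf1 mf2 a0 b0 le fe1 fe2.
have mn (h : T -> R) : measurable_fun setT h ->
    measurable_fun setT (fun x => (`|h x|)%:E).
  by move=> mh; apply/measurable_EFinP; exact: measurableT_comp.
have mZ c (h : T -> R) : measurable_fun setT h ->
    measurable_fun setT (fun x => c%:E * (`|h x|)%:E)%E.
  by move=> mh; apply: emeasurable_funM => //; exact: mn.
apply: (@le_trans _ _ (\int[mu]_x (a%:E * `|f1 x|%:E + b%:E * `|f2 x|%:E))%E).
  apply: ge0_le_integral => //.
  - exact: mn.
  - by apply: emeasurable_funD; exact: mZ.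
  - by move=> x _; rewrite -!EFinM -EFinD lee_fin.
rewrite ge0_integralD//; last 4 first.
  - by move=> x _; rewrite -EFinM lee_fin mulr_ge0.
  - exact: mZ.
  - by move=> x _; rewrite -EFinM lee_fin mulr_ge0.
  - exact: mZ.
rewrite !ge0_integralZl_EFin//; [|exact: mn|exact: mn].
by rewrite EFinD !EFinM leeD// lee_wpmul2l// lee_fin.
Qed.

Section finite_rank_approximation.
Context {d} {T : measurableType d} {R : realType}.
Variable mu : {finite_measure set T -> \bar R}.
Let nu := (mu \x mu)%E.

(** The inductive form makes closure under products, the key property below, a
double induction; [finite_rankP] recovers the explicit sum. *)
Inductive finite_rank : (T * T -> R) -> Prop :=
| finite_rank_rect a b r s of bmeas a r & bmeas b s :
    finite_rank (fun p => a p.1 * b p.2)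
| finite_rank_add F G of finite_rank F & finite_rank G :
    finite_rank (fun p => F p + G p).

Lemma finite_rank_cst c : finite_rank (cst c).
Proof.
rewrite (_ : cst c = fun p : T * T => cst c p.1 * cst 1 p.2).
  exact: finite_rank_rect (bmeas_cst _) (bmeas_cst _).
by apply/funext => p /=; rewrite mulr1.
Qed.

Lemma finite_rankM F G : finite_rank F -> finite_rank G ->
  finite_rank (fun p => F p * G p).
Proof.
move=> hF hG; elim: hF => {F} [a b r s ha hb|F1 F2 _ IH1 _ IH2].
- elim: hG => {G} [a' b' r' s' ha' hb'|G1 G2 _ IH1 _ IH2].
    rewrite (_ : (fun _ => _) =
        fun p : T * T => (a p.1 * a' p.1) * (b p.2 * b' p.2)).
      exact: finite_rank_rect (bmeasM ha ha') (bmeasM hb hb').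
    by apply/funext => p; rewrite mulrACA.
  rewrite (_ : (fun _ => _) = fun p : T * T =>
      a p.1 * b p.2 * G1 p + a p.1 * b p.2 * G2 p); first exact: finite_rank_add.
  by apply/funext => p; rewrite mulrDr.
- rewrite (_ : (fun _ => _) = fun p : T * T => F1 p * G p + F2 p * G p).
    exact: finite_rank_add.
  by apply/funext => p; rewrite mulrDl.
Qed.

Lemma finite_rank_lin c e F : finite_rank F -> finite_rank (fun p => c * F p + e).
Proof.
move=> hF; apply: finite_rank_add; last exact: finite_rank_cst.
by apply: finite_rankM => //; exact: finite_rank_cst.
Qed.

Lemma finite_rank_measurable F : finite_rank F -> measurable_fun setT F.
Proof.
elim=> [a b r s [ma _] [mb _]|G H _ mG _ mH]; last exact: measurable_funD.
by apply: measurable_funM; exact: measurableT_comp.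
Qed.

Lemma finite_rankP F : finite_rank F ->
  exists n (a b : 'I_n -> T -> R) (r s : 'I_n -> R),
    [/\ forall i, bmeas (a i) (r i), forall i, bmeas (b i) (s i) &
        F = fun p => \sum_i a i p.1 * b i p.2].
Proof.
elim=> [a b r s ha hb|G H _ [n [a [b [r [s [ha hb ->]]]]]]
    _ [m [a' [b' [r' [s' [ha' hb' ->]]]]]]].
  exists 1%N, (fun=> a), (fun=> b), (fun=> r), (fun=> s); split => //.
  by apply/funext => p; rewrite big_ord1.
pose glue (X : Type) (u : 'I_n -> X) (v : 'I_m -> X) (i : 'I_(n + m)) :=
  match fintype.split i with inl j => u j | inr j => v j end.
have gluel X (u : 'I_n -> X) v j : glue X u v (lshift m j) = u j.
  by rewrite /glue (unsplitK (inl j)).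
have gluer X (u : 'I_n -> X) v j : glue X u v (rshift n j) = v j.
  by rewrite /glue (unsplitK (inr j)).
exists (n + m)%N, (glue _ a a'), (glue _ b b'), (glue _ r r'), (glue _ s s').
split.
- by move=> i; rewrite /glue; case: fintype.split.
- by move=> i; rewrite /glue; case: fintype.split.
- apply/funext => p; rewrite big_split_ord/=.
  by congr (_ + _); apply: eq_bigr => i _; rewrite ?gluel ?gluer.
Qed.

Lemma finite_product : (nu setT < +oo)%E.
Proof.
rewrite /nu -setXTT product_measure1E// lte_mul_pinfty//.
- by rewrite fin_num_measure.
- by rewrite -ge0_fin_numE// fin_num_measure.
Qed.

Let near (H F : T * T -> R) e := (\int[nu]_p `|H p - F p|%:E <= e%:E)%E.

Let approximable H := forall e, 0 < e -> exists F,
  [/\ finite_rank F, forall p, 0 <= F p <= 1 & near H F e].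

(** The indicator of a union is 1 - (1 - a)(1 - b), so the same polynomial in
the approximants works.  It keeps values in [0,1], which is what allows a bound
independent of the precision. *)
Let approximableU (A B : set (T * T)) : measurable A -> measurable B ->
  approximable \1_A -> approximable \1_B -> approximable \1_(A `|` B).
Proof.
move=> mA mB hA hB e e0.
have e20 : 0 < e / 2 by rewrite divr_gt0.
have [F [fF F01 nF]] := hA _ e20; have [G [fG G01 nG]] := hB _ e20.
have mF := finite_rank_measurable fF; have mG := finite_rank_measurable fG.
exists (fun p => F p + G p + (-1) * (F p * G p) + 0); split.
- have -> : (fun p => F p + G p + -1 * (F p * G p) + 0) =
      (fun p => (F p + G p) + (-1 * (F p * G p) + 0)).
    by apply/funext => p; rewrite -!addrA.
  by apply: finite_rank_add; [exact: finite_rank_add|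
    apply: finite_rank_lin; exact: finite_rankM].
- move=> p; move: (F01 p) (G01 p) => /andP[? ?] /andP[? ?].
  by apply/andP; split; nra.
rewrite /near (_ : e = 1 * (e / 2) + 1 * (e / 2)); last by field.
apply: (@le_integral_comb _ _ _ nu _ (fun p => \1_A p - F p) (fun p => \1_B p - G p)) => //.
- apply: measurable_funB; first by apply: measurable_indic; exact: measurableU.
  by repeat (apply: measurable_funD || apply: measurable_funM) => //.
- by apply: measurable_funB => //; exact: measurable_indic.
- by apply: measurable_funB => //; exact: measurable_indic.
move=> p; rewrite !mul1r.
have -> : \1_(A `|` B) p - (F p + G p + -1 * (F p * G p) + 0) =
    (\1_A p - F p) * (1 - \1_B p) + (\1_B p - G p) * (1 - F p) :> R.
  rewrite !indicE in_setU; case: (p \in A); case: (p \in B) => /=; ring.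
rewrite (le_trans (ler_normD _ _))// lerD// normrM ler_piMr//.
  by rewrite indicE; case: (p \in B); rewrite ?subrr ?subr0 ?normr0 ?normr1.
by move: (F01 p) => /andP[? ?]; rewrite ger0_norm ?subr_ge0//; lra.
Qed.

(** In a finite measure space a countable union is close to a finite one. *)
Let approximable_bigcup (A : (set (T * T))^nat) : (forall n, measurable (A n)) ->
  (forall n, approximable \1_(A n)) -> approximable \1_(\bigcup_n A n).
Proof.
move=> mA hA e e0.
pose U n := \big[setU/set0]_(i < n) A i.
have mU n : measurable (U n) by exact: bigsetU_measurable.
have hU n : approximable \1_(U n).
  rewrite /U; elim: n => [|n IHn]; last first.
    rewrite big_ord_recr; apply: approximableU => //.
    exact: bigsetU_measurable.
  move=> e' e'0; exists (cst 0); split; first exact: finite_rank_cst.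
    by move=> p; rewrite lexx ler01.
  rewrite /near big_ord0 indic0.
  under eq_integral do rewrite subr0 normr0.
  by rewrite integral0 lee_fin ltW.
pose D n := (\bigcup_n A n) `\` U n.
have mD n : measurable (D n) by apply: measurableD => //; exact: bigcup_measurable.
have D0 : \bigcap_n D n = set0.
  rewrite -subset0 => p Dp; have [[n _ An] _] := Dp 0%N I.
  have [_ /=] := Dp n.+1 I; apply.
  by rewrite /U big_ord_recr; right.
have : (nu \o D) n @[n --> \oo] --> 0%E.
  rewrite -(measure0 nu) -D0; apply: nonincreasing_cvg_mu => //.
  - apply: le_lt_trans finite_product.
    by apply: le_measure; rewrite ?inE.
  - exact: bigcap_measurable.
  - move=> n m nm; apply/subsetPset; apply: setDS.
    exact: subset_bigsetU.
have e20 : 0 < e / 2 by rewrite divr_gt0.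
move/fine_cvgP => [fD] /cvgrPdist_le/(_ _ e20) Ne.
near \oo => N.
have nuD : (nu (D N) <= (e / 2)%:E)%E.
  have fN : nu (D N) \is a fin_num by near: N.
  rewrite -(fineK fN) lee_fin.
  have : `|0 - fine (nu (D N))| <= e / 2 by near: N.
  by apply: le_trans; rewrite sub0r normrN ler_norm.
have [F [fF F01 nF]] := hU N _ e20.
exists F; split => //.
rewrite /near (_ : e = 1 * (e / 2) + 1 * (e / 2)); last by field.
have mF := finite_rank_measurable fF.
apply: (@le_integral_comb _ _ _ nu _ \1_(D N) (fun p => \1_(U N) p - F p)) => //.
- apply: measurable_funB => //; apply: measurable_indic; exact: bigcup_measurable.
- by apply: measurable_funB => //; exact: measurable_indic.
- move=> p; rewrite !mul1r.
  have -> : \1_(\bigcup_n A n) p - F p = \1_(D N) p + (\1_(U N) p - F p).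
    rewrite addrA; congr (_ - _).
    have : U N `<=` \bigcup_n A n.
      by move=> q; rewrite /U -bigcup_mkord => -[k _ Ak]; exists k.
    rewrite !indicE /D in_setD => UA.
    have [Up|Up] := boolP (p \in U N); last by rewrite andbT addr0.
    by rewrite andbF (mem_set (UA _ (set_mem Up))) add0r.
  exact: ler_normD.
- under eq_integral do rewrite ger0_norm// .
  by rewrite integral_indic// setIT.
Unshelve. all: by end_near. Qed.

(** Approximable sets form a sigma-algebra that contains the rectangles. *)
Lemma indic_approximable (A : set (T * T)) : measurable A ->
  forall e, 0 < e -> exists F,
    [/\ finite_rank F, forall p, 0 <= F p <= 1 & near \1_A F e].
Proof.
move=> mA; suff sub : @measurable _ (T * T)%type `<=`
    [set A | measurable A /\ approximable \1_A] by case: (sub A mA).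
rewrite {1}measurable_prod_measurableType; apply: smallest_sub.
  split.
  - split; first exact: measurable0.
    move=> e e0; exists (cst 0); split; first exact: finite_rank_cst.
      by move=> p; rewrite lexx ler01.
    rewrite /near indic0; under eq_integral do rewrite subr0 normr0.
    by rewrite integral0 lee_fin ltW.
  - move=> B [mB hB]; rewrite setTD; split; first exact: measurableC.
    move=> e e0; have [F [fF F01 nF]] := hB _ e0.
    exists (fun p => -1 * F p + 1); split; first exact: finite_rank_lin.
      by move=> p; move: (F01 p) => /andP[? ?]; apply/andP; split; lra.
    apply: le_trans nF; rewrite le_eqVlt; apply/orP; left; apply/eqP.
    apply: eq_integral => p _; congr (_%:E).
    rewrite -normrN; congr (`| _ |); rewrite !indicE in_setC.
    by case: (p \in B) => /=; ring.
  - move=> B hB; split; first by apply: bigcup_measurable => k _; case: (hB k).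
    by apply: approximable_bigcup => n; case: (hB n).
move=> _ [B mB [C mC <-]]; split; first exact: measurableX.
move=> e e0; exists (\1_(B `*` C)); split.
- rewrite (_ : \1_(B `*` C) = fun p => \1_B p.1 * \1_C p.2 :> R); last first.
    apply/funext => p; rewrite !indicE in_setX.
    by case: (p.1 \in B); case: (p.2 \in C) => /=; rewrite ?mulr0 ?mulr1.
  by apply: (@finite_rank_rect _ _ 1 1); split;
    [exact: measurable_indic|move=> x; rewrite indicE; case: (x \in _);
     rewrite ?normr1 ?normr0|exact: measurable_indic|move=> x;
     rewrite indicE; case: (x \in _); rewrite ?normr1 ?normr0].
- by move=> p; rewrite indicE; case: (p \in _) => /=; rewrite lexx ler01.
- rewrite /near; under eq_integral do rewrite subrr normr0.
  by rewrite integral0 lee_fin ltW.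
Qed.

(** The first binary digit of H is an indicator, and the rest of H is half of
another function with values in [0,1]: each digit halves the error. *)
Let approximable_fun01 n (H : T * T -> R) : measurable_fun setT H -> (forall p, 0 <= H p <= 1) ->
  forall e, 0 < e -> exists F, [/\ finite_rank F, forall p, 0 <= F p <= 1 &
    near H F (2^-1 ^+ n * fine (nu setT) + e)].
Proof.
elim: n H => [|n IHn] H mH H01 e e0.
  exists (cst 0); split; first exact: finite_rank_cst.
    by move=> p; rewrite lexx ler01.
  rewrite /near expr0 mul1r; apply: (@le_trans _ _ (fine (nu setT))%:E).
    rewrite fineK ?ge0_fin_numE ?finite_product//.
    rewrite -[leRHS]mul1e -integral_cst//; apply: ge0_le_integral => //.
    - apply/measurable_EFinP; apply: measurableT_comp => //.
      by apply: measurable_funB.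
    - by move=> p _; rewrite lee_fin subr0; move: (H01 p) => /andP[? ?];
        rewrite ger0_norm.
  by rewrite lee_fin lerDl ltW.
pose A := [set p | 2^-1 <= H p].
have mA : measurable A.
  rewrite (_ : A = setT `&` H @^-1` `[2^-1, +oo[); first exact: mH.
  by rewrite setTI; apply/seteqP; split=> p /=; rewrite in_itv/= andbT.
pose H' p := 2 * H p - \1_A p.
have mH' : measurable_fun setT H'.
  by apply: measurable_funB; [exact: measurable_funM|exact: measurable_indic].
have H'01 p : 0 <= H' p <= 1.
  rewrite /H' indicE; have [Ap|Ap] := boolP (p \in A) => /=.
    by move/set_mem: Ap; rewrite /A/= => Ap; move: (H01 p); lra.
  by move/negP: Ap; rewrite inE /A/= => /negP; rewrite -ltNge => Ap; move: (H01 p); lra.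
have [F [fF F01 nF]] := IHn H' mH' H'01 _ e0.
have [G [fG G01 nG]] := indic_approximable mA e0.
exists (fun p => (2^-1 * F p + 0) + (2^-1 * G p + 0)); split.
- by apply: finite_rank_add; exact: finite_rank_lin.
- by move=> p; move: (F01 p) (G01 p); lra.
rewrite /near exprS.
have -> : 2^-1 * 2^-1 ^+ n * fine (nu [set: T * T]) + e =
   2^-1 * (2^-1 ^+ n * fine (nu [set: T * T]) + e) + 2^-1 * e by field.
have mF := finite_rank_measurable fF; have mG := finite_rank_measurable fG.
apply: (@le_integral_comb _ _ _ nu _ (fun p => H' p - F p) (fun p => \1_A p - G p)) => //.
- apply: measurable_funB => //.
  by repeat (apply: measurable_funD || apply: measurable_funM) => //.
- exact: measurable_funB.
- by apply: measurable_funB => //; exact: measurable_indic.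
move=> p; have -> : H p - (2^-1 * F p + 0 + (2^-1 * G p + 0)) =
    2^-1 * (H' p - F p) + 2^-1 * (\1_A p - G p) by rewrite /H'; field.
by rewrite (le_trans (ler_normD _ _))// !normrM [`|2^-1|]ger0_norm.
Qed.

(** The bound C on the approximant does not depend on e; the choice of the mixed
norm in [contractiveD] relies on this. *)
Lemma finite_rank_approx (H : T * T -> R) (C : R) : 0 < C -> measurable_fun setT H ->
  (forall p, `|H p| <= C) -> forall e, 0 < e -> exists F,
  [/\ finite_rank F, forall p, `|F p| <= C &
      (\int[nu]_p `|H p - F p|%:E <= e%:E)%E].
Proof.
move=> C0 mH HC e e0.
pose H' p := (2 * C)^-1 * H p + 2^-1.
have mH' : measurable_fun setT H'.
  by apply: measurable_funD => //; exact: measurable_funM.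
have H'01 p : 0 <= H' p <= 1.
  have : `|C^-1 * H p| <= 1.
    by rewrite normrM gtr0_norm ?invr_gt0// ler_pdivrMl// mulr1.
  by rewrite ler_norml /H' invfM => /andP[]; rewrite -mulrA; lra.
pose e' := e / (4 * C).
have e'0 : 0 < e' by rewrite divr_gt0// mulr_gt0.
have [n ne] : exists n, 2^-1 ^+ n * fine (nu setT) <= e' :> R.
  have : (fun n => 2^-1 ^+ n * fine (nu setT)) @ \oo --> (0 : R).
    rewrite -[X in _ --> X](mul0r (fine (nu setT))); apply: cvgMl.
    by apply: cvg_expr; rewrite ger0_norm// invf_lt1// ltr1n.
  move/cvgrPdist_le => /(_ _ e'0)[n _ /(_ n (leqnn n)) /=] h; exists n.
  by apply: le_trans h; rewrite sub0r normrN ler_norm.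
have [F [fF F01 nF]] := approximable_fun01 n mH' H'01 e'0.
exists (fun p => 2 * C * F p + - C); split; first exact: finite_rank_lin.
  move=> p; rewrite ler_norml; move: (F01 p) => /andP[? ?].
  by apply/andP; split; nra.
rewrite (_ : e = 2 * C * (e' + e') + 0 * 0); last first.
  by rewrite /e'; field; rewrite gt_eqF.
have mF := finite_rank_measurable fF.
apply: (@le_integral_comb _ _ _ nu _ (fun p => H' p - F p) (cst 0)) => //.
- apply: measurable_funB => //; apply: measurable_funD => //.
  exact: measurable_funM.
- exact: measurable_funB.
- by rewrite mulr_ge0// ltW.
- move=> p; rewrite mul0r addr0.
  have -> : H p - (2 * C * F p + - C) = 2 * C * (H' p - F p).
    by rewrite /H'; field; rewrite gt_eqF.
  by rewrite normrM ger0_norm// mulr_ge0// ltW.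
- by apply: (le_trans nF); rewrite lee_fin lerD2r.
- by under eq_integral do rewrite normr0; rewrite integral0.
Qed.

End finite_rank_approximation.
(** * The Fredholm alternative for bounded functions *)

Lemma geometric_tail0 {R : realType} (z c : R) :
  (forall n, `|z| <= c * 2^-1 ^+ n) -> z = 0.
Proof.
move=> zc; apply/normr0_eq0/eqP; rewrite eq_le normr_ge0 andbT.
apply/ler_addgt0Pr => e e0; rewrite add0r.
have : (fun n => c * 2^-1 ^+ n) @ \oo --> (0 : R).
  rewrite -[X in _ --> X](mulr0 c); apply: cvgMr.
  by apply: cvg_expr; rewrite ger0_norm// invf_lt1// ltr1n.
move/cvgrPdist_le => /(_ _ e0)[n _ /(_ n (leqnn n)) /=].
rewrite sub0r normrN => h; apply: le_trans (zc n) _.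
by apply: le_trans h; exact: ler_norm.
Qed.

Section fredholm.
Context {d} {T : measurableType d} {R : realType}.
Variable mu : {finite_measure set T -> \bar R}.
Implicit Types (H K S : T * T -> R) (f b : T -> R) (a C m r : R).
Let nu := (mu \x mu)%E.
Let muT := fine (mu setT).

Let muTE : mu setT = muT%:E.
Proof. by rewrite fineK// fin_num_measure. Qed.

Let muT0 : 0 <= muT.
Proof. by rewrite fine_ge0. Qed.

Let int_normr_le f C : measurable_fun setT f -> (forall x, `|f x| <= C) -> 0 <= C ->
  (\int[mu]_x `|f x|%:E <= (C * muT)%:E)%E.
Proof.
move=> mf fC C0; rewrite EFinM -muTE.
apply: (@integral_le_bound _ _ _ mu setT (EFin \o f) C%:E) => //.
  exact/measurable_EFinP.
by apply: aeW => x _; rewrite lee_fin.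
Qed.

Lemma bounded_schur H C : measurable_fun setT H -> 0 <= C ->
  (forall p, `|H p| <= C) -> schur mu H (C * muT).
Proof.
move=> mH C0 HC; split => //; first exact: mulr_ge0.
- by move=> x; apply: int_normr_le => //; exact: measurable_slice.
- by move=> y; apply: int_normr_le => //; exact: measurable_slice2.
Qed.

Lemma schurD H K m n : schur mu H m -> schur mu K n ->
  schur mu (fun p => H p + K p) (m + n).
Proof.
move=> [m0 mH H1 H2] [n0 mK K1 K2]; split; first exact: addr_ge0.
- exact: measurable_funD.
- move=> x; rewrite -(mul1r m) -(mul1r n).
  apply: (@le_integral_comb _ _ _ mu _ (fun y => H (x, y)) (fun y => K (x, y))) => //.
  + by apply: measurable_funD; exact: measurable_slice.
  + exact: measurable_slice.
  + exact: measurable_slice.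
  + by move=> y; rewrite !mul1r ler_normD.
- move=> y; rewrite -(mul1r m) -(mul1r n).
  apply: (@le_integral_comb _ _ _ mu _ (fun x => H (x, y)) (fun x => K (x, y))) => //.
  + by apply: measurable_funD; exact: measurable_slice2.
  + exact: measurable_slice2.
  + exact: measurable_slice2.
  + by move=> x; rewrite !mul1r ler_normD.
Qed.

(** Together with [small_kernel_op_L1]: a bounded kernel that is small in L^1 of the
product need not be a contraction in the sup norm, but it is one in a norm mixing
the sup norm and the L^1 norm. *)
Lemma bounded_kernel_op_L1 S C f r l x : measurable_fun setT S -> 0 <= C ->
  (forall p, `|S p| <= C) -> bmeas f r -> (\int[mu]_x `|f x|%:E <= l%:E)%E ->
  `|kernel_op mu S f x| <= C * l.
Proof.
move=> mS C0 SC bf fl.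
have [int _] := schur_slice x (bounded_schur mS C0 SC) bf.
have [mf _] := bf.
rewrite -lee_fin EFin_normr_Rintegral//.
apply: (@le_trans _ _ (\int[mu]_y (C%:E * `|f y|%:E))%E).
  apply: (@le_trans _ _ (\int[mu]_y `|S (x, y) * f y|%:E)%E).
    by apply: le_abse_integral => //; case/integrableP : int.
  apply: ge0_le_integral => //.
  - apply/measurable_EFinP; apply: measurableT_comp => //.
    by apply: measurable_funM => //; exact: measurable_slice.
  - by apply/measurable_EFinP; apply: measurable_funM => //; exact: measurableT_comp.
  - by move=> y _; rewrite -EFinM lee_fin normrM ler_wpM2r.
rewrite ge0_integralZl_EFin//; last by apply/measurable_EFinP; exact: measurableT_comp.
by rewrite EFinM lee_wpmul2l// lee_fin.
Qed.

Lemma small_kernel_op_L1 S C f r e : measurable_fun setT S -> 0 <= C -> 0 <= r ->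
  (forall p, `|S p| <= C) -> bmeas f r -> (\int[nu]_p `|S p|%:E <= e%:E)%E ->
  (\int[mu]_x `|kernel_op mu S f x|%:E <= (r * e)%:E)%E.
Proof.
move=> mS C0 r0 SC bf Se; have sS := bounded_schur mS C0 SC; have [mf fr] := bf.
have mS' : measurable_fun setT (fun p => (`|S p|)%:E).
  by apply/measurable_EFinP; exact: measurableT_comp.
have mSf : measurable_fun setT (fun p : T * T => (`|S p * f p.2|)%:E).
  by apply/measurable_EFinP; apply: measurableT_comp => //; exact: measurable_kernelM.
apply: (@le_trans _ _ (\int[mu]_x \int[mu]_y `|S (x, y) * f y|%:E)%E).
  apply: ge0_le_integral => //.
  - apply/measurable_EFinP; apply: measurableT_comp => //.
    exact: measurable_kernel_op sS bf.
  - exact: (@measurable_fun_fubini_tonelli_F _ _ _ _ _ mu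
        (fun p => (`|S p * f p.2|)%:E)).
  - move=> x _; have [int _] := schur_slice x sS bf.
    rewrite EFin_normr_Rintegral//.
    by apply: le_abse_integral => //; case/integrableP : int.
rewrite -(@fubini_tonelli1 _ _ _ _ _ mu mu (fun p => (`|S p * f p.2|)%:E))//.
apply: (@le_trans _ _ (\int[nu]_p (r%:E * `|S p|%:E))%E).
  apply: ge0_le_integral => //.
  - by apply: emeasurable_funM.
  - by move=> p _; rewrite -EFinM lee_fin normrM mulrC ler_wpM2r.
rewrite ge0_integralZl_EFin//.
by rewrite EFinM lee_wpmul2l// lee_fin.
Qed.

(** K halves the norm max(|f|_oo, a |f|_1), stated through its balls. *)
Definition contractive K a := [/\ 0 < a, exists m, schur mu K m &
  forall f r, 0 <= r -> bmeas f r -> (\int[mu]_x `|f x|%:E <= (r / a)%:E)%E ->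
    (forall x, `|kernel_op mu K f x| <= r / 2) /\
    (\int[mu]_x `|kernel_op mu K f x|%:E <= (r / 2 / a)%:E)%E].

(** Each of the four contributions is at most a quarter of the radius: K has Schur
norm 1/4; S maps the L^1 ball of radius r / (4 C) into the sup ball of radius r / 4,
and the sup ball of radius r into the L^1 ball of radius r / (16 C). *)
Lemma contractiveD K S C : schur mu K 4^-1 -> measurable_fun setT S -> 0 < C ->
  (forall p, `|S p| <= C) -> (\int[nu]_p `|S p|%:E <= (16 * C)^-1%:E)%E ->
  contractive (fun p => K p + S p) (4 * C).
Proof.
move=> sK mS C0 SC Se; have sS := bounded_schur mS (ltW C0) SC.
split; first exact: mulr_gt0.
  by exists (4^-1 + C * muT); exact: schurD.
move=> f r r0 bf fl.
have Cn0 : C != 0 by rewrite gt_eqF.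
have KS x : kernel_op mu (fun p => K p + S p) f x = kernel_op mu K f x + kernel_op mu S f x.
  exact: kernel_op_addr sK sS bf.
split=> [x|].
  rewrite KS (le_trans (ler_normD _ _))//.
  have := kernel_op_bound x sK bf.
  have := bounded_kernel_op_L1 x mS (ltW C0) SC bf fl.
  have -> : C * (r / (4 * C)) = r / 4 by field.
  lra.
rewrite (_ : _ / _ / _ = 1 * (4^-1 * (r / (4 * C))) + 1 * (r * (16 * C)^-1)); last by field.
have mk := measurable_kernel_op sK bf; have mk' := measurable_kernel_op sS bf.
apply: (@le_integral_comb _ _ _ mu _ (kernel_op mu K f) (kernel_op mu S f)) => //.
- exact: measurable_kernel_op (schurD sK sS) bf.
- by move=> x; rewrite KS !mul1r ler_normD.
- exact: le_L1_kernel_op sK bf fl.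
- exact: small_kernel_op_L1 mS (ltW C0) r0 SC bf Se.
Qed.

(** The Neumann series converges geometrically in the sup norm, since its terms
are halved in the mixed norm; the limit is therefore taken pointwise. *)
Lemma neumann K a : contractive K a -> exists2 B, 0 <= B &
  forall b r, 0 <= r -> bmeas b r -> exists f,
    bmeas f (B * r) /\ forall x, f x - kernel_op mu K f x = b x.
Proof.
move=> [a0 [m sK] cK].
exists (2 * (1 + a * muT)).
  by rewrite mulr_ge0// addr_ge0// mulr_ge0// ltW.
move=> b r r0 bb.
(* the mixed norm of b is at most B, as |b|_1 <= muT r *)
pose B := (1 + a * muT) * r.
have aT0 : 0 <= a * muT by rewrite mulr_ge0// ltW.
have B0 : 0 <= B by rewrite mulr_ge0// addr_ge0.
pose u n := iter n (kernel_op mu K) b.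
have uB n : bmeas (u n) (B * 2^-1 ^+ n) /\
    (\int[mu]_x `|u n x|%:E <= (B * 2^-1 ^+ n / a)%:E)%E.
  elim: n => [|n [IH1 IH2]].
    have [mb br] := bb; rewrite expr0 mulr1; split.
      split=> // x; apply: le_trans (br x) _.
      by rewrite -[leLHS]mul1r ler_wpM2r// lerDl.
    apply: le_trans (int_normr_le mb br r0) _.
    by rewrite lee_fin ler_pdivlMr// /B; lra.
  have Bn0 : 0 <= B * 2^-1 ^+ n by rewrite mulr_ge0// exprn_ge0.
  have [h1 h2] := cK _ _ Bn0 IH1 IH2.
  rewrite exprSr mulrA; split => //; split=> //.
  exact: measurable_kernel_op sK IH1.
pose F n x := \sum_(k < n) u k x.
have bF n : bmeas (F n) (\sum_(k < n) B * 2^-1 ^+ k).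
  by apply: bmeas_sum => k; case: (uB k).
have tail n k x : `|F (n + k)%N x - F n x| <= 2 * B * 2^-1 ^+ n - 2 * B * 2^-1 ^+ (n + k).
  elim: k => [|k IHk]; first by rewrite addn0 !subrr normr0.
  rewrite addnS /F big_ord_recr/= -/(F (n + k)%N x) addrAC.
  have [[_ /(_ x)] ] := uB (n + k)%N.
  move: IHk; rewrite exprS; set q := 2^-1 ^+ (n + k) => IHk h _.
  rewrite (le_trans (ler_normD _ _))//.
  have -> : 2 * B * (2^-1 * q) = B * q by field.
  lra.
have cF x : cvgn (F ^~ x).
  have -> : F ^~ x = series (u ^~ x).
    by apply/funext => n; rewrite /F seriesEord.
  apply: normed_cvg; apply: (@series_le_cvg _ _ (geometric B 2^-1)) => //.
  - by move=> n /=.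
  - by move=> n; rewrite /= mulr_ge0// exprn_ge0.
  - by move=> n; case: (uB n) => -[_ /(_ x)].
  - by apply: is_cvg_geometric_series; rewrite ger0_norm// invf_lt1// ltr1n.
pose f x := limn (F ^~ x).
have fF n x : `|f x - F n x| <= 2 * B * 2^-1 ^+ n.
  apply/ler_addgt0Pr => e e0.
  have [N _ /(_ (N + n)%N)] := (@cvgrPdist_le _ _ _ _ _ _ _).1 (cF x) _ e0.
  rewrite /= leq_addr addnC => /(_ isT) h.
  have := tail n N x.
  have : 0 <= 2 * B * 2^-1 ^+ (n + N) by rewrite mulr_ge0// ?exprn_ge0// mulr_ge0.
  have : `|f x - F n x| <= `|f x - F (n + N)%N x| + `|F (n + N)%N x - F n x|.
    by rewrite (le_trans _ (ler_normD _ _))// addrA subrK.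
  move: h; rewrite -/(f x); lra.
have bf : bmeas f (2 * B).
  split; last by move=> x; have := fF 0%N x; rewrite /F big_ord0 subr0 mulr1.
  by apply: (measurable_fun_cvg (h := F)) => [n|x _]; [case: (bF n)|exact: cF].
exists f; rewrite -mulrA; split => // x.
apply/eqP; rewrite -subr_eq0; apply/eqP.
apply: (@geometric_tail0 _ _ (2 * B + m * (2 * B))) => n.
have FE : F n.+1 x = b x + kernel_op mu K (F n) x.
  rewrite /F big_ord_recl/=; congr (_ + _).
  transitivity (kernel_op mu K (fun y => \sum_(k < n) 1 * u k y) x).
    rewrite (@kernel_op_sum _ _ _ _ _ m _ _ (fun k : 'I_n => u k) (fun k => B * 2^-1 ^+ k))//.
      by apply: eq_bigr => k _; rewrite mul1r.
    by move=> k; case: (uB k).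
  by congr (kernel_op _ _ _ _); apply/funext => y; apply: eq_bigr => k _; rewrite mul1r.
have bd : bmeas (fun y => f y + (-1) * F n y) (2 * B * 2^-1 ^+ n).
  split; last by move=> y; rewrite mulN1r; exact: fF.
  by case: bf => mf _; case: (bF n) => mF _; apply: measurable_funD => //;
    exact: measurable_funM.
have := kernel_op_bound x sK bd; rewrite (kernel_opD (-1) x sK bf (bF n)) => h1.
have h2 := fF n.+1 x; rewrite exprS in h2; rewrite FE in h2.
have : f x - kernel_op mu K f x - b x =
   (f x - (b x + kernel_op mu K (F n) x)) - (kernel_op mu K f x + (-1) * kernel_op mu K (F n) x).
  by ring.
move=> ->; rewrite (le_trans (ler_normB _ _))//.
have : 0 <= B * 2^-1 ^+ n by rewrite mulr_ge0// exprn_ge0.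
move: h1 h2; set q := 2^-1 ^+ n; move=> h1 h2 q0; rewrite mulrDl; nra.
Qed.

(** With K = H1 + S contractive and F = sum_k a_k b_k the finite rank part, a
solution of f - K f - F f = b is sought as be + sum_k c_k al_k, where
be - K be = b and al_k - K al_k = a_k.  The coefficients must satisfy
c_k = <b_k,be> + sum_l <b_k,al_l> c_l.  A nonzero solution of the homogeneous
linear system would give a solution of the homogeneous integral equation with
nonzero <b_k,f> for some k, against the injectivity assumption. *)
Theorem fredholm_alternative (H1 H2 : T * T -> R) C :
  schur mu H1 4^-1 -> measurable_fun setT H2 -> 0 < C -> (forall p, `|H2 p| <= C) ->
  (forall f r, bmeas f r -> (forall x, f x = kernel_op mu (fun p => H1 p + H2 p) f x) ->
    {ae mu, forall x, f x = 0}) ->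
  exists2 B, 0 <= B & forall b r, 0 <= r -> bmeas b r -> exists f,
    bmeas f (B * r) /\ forall x, f x - kernel_op mu (fun p => H1 p + H2 p) f x = b x.
Proof.
move=> sH1 mH2 C0 H2C inj.
have [[x0 _]|T0] := pselect (exists x : T, True); last first.
  exists 0 => // b r r0 [mb br]; exists b.
  by do 2?split => //; move=> x; exfalso; apply: T0; exists x.
have C20 : 0 < 2 * C by rewrite mulr_gt0.
have e0 : 0 < (16 * (2 * C))^-1 by rewrite invr_gt0 mulr_gt0.
have [F [fF FC HF]] := finite_rank_approx mu C0 mH2 H2C e0.
have mF := finite_rank_measurable fF.
pose S p := H2 p - F p.
have mS : measurable_fun setT S by exact: measurable_funB.
have SC p : `|S p| <= 2 * C.
  by rewrite (le_trans (ler_normB _ _))//; move: (H2C p) (FC p); lra.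
have cK := contractiveD sH1 mS C20 SC HF.
pose K p := H1 p + S p.
have [_ [m sK] _] := cK.
have [B0 B00 solve] := neumann cK.
have [n [a [b' [r0 [s0 [ha hb FE]]]]]] := finite_rankP fF.
have ha' k : bmeas (a k) `|r0 k|.
  by split; [case: (ha k)|move=> x; case: (ha k) => _ /(_ x)/le_trans->//;
     exact: ler_norm].
have hb' k : bmeas (b' k) `|s0 k|.
  by split; [case: (hb k)|move=> x; case: (hb k) => _ /(_ x)/le_trans->//;
     exact: ler_norm].
have /choice[al hal] k : exists f,
    bmeas f (B0 * `|r0 k|) /\ forall x, f x - kernel_op mu K f x = a k x.
  exact: solve.
have bal k := (hal k).1.
pose pair g f := kernel_op mu (fun p => g p.2) f x0.
have spair k : schur mu (fun p => b' k p.2) (`|s0 k| * muT).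
  apply: bounded_schur => //.
    by case: (hb k) => mb _; exact: measurableT_comp.
  by move=> p; case: (hb' k).
have KF f r x : bmeas f r -> kernel_op mu (fun p => H1 p + H2 p) f x =
    kernel_op mu K f x + \sum_k pair (b' k) f * a k x.
  move=> bf; have -> : (fun p => H1 p + H2 p) = fun p => K p + F p.
    by apply/funext => p; rewrite /K /S addrA addrNK.
  have sF := bounded_schur mF (ltW C0) FC.
  rewrite (kernel_op_addr _ sK sF bf); congr (_ + _).
  have s1 : schur mu (cst 1) (1 * muT).
    by apply: bounded_schur => // p; rewrite normr1.
  transitivity (kernel_op mu (cst 1) (fun y => \sum_k a k x * (b' k y * f y)) x).
    rewrite /kernel_op FE; apply: eq_Rintegral => y _ /=.
    by rewrite mul1r big_distrl/=; apply: eq_bigr => k _; rewrite mulrA.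
  rewrite (@kernel_op_sum _ _ _ _ _ _ _ _ (fun k y => b' k y * f y)
    (fun k => `|s0 k| * r) _ _ s1).
    apply: eq_bigr => k _; rewrite mulrC; congr (_ * _).
    by apply: eq_Rintegral => y _ /=; rewrite mul1r.
  by move=> k; exact: bmeasM.
have pairD k f r c : bmeas f r -> pair (b' k) (fun y => f y + 1 * \sum_l c l * al l y) =
    pair (b' k) f + \sum_l pair (b' k) (al l) * c l.
  move=> bf; have bs : bmeas (fun y => \sum_l c l * al l y)
      (\sum_l `|c l| * (B0 * `|r0 l|)) by apply: bmeas_sum => l; exact: bmeasZ.
  rewrite /pair (kernel_opD _ _ (spair k) bf bs) mul1r; congr (_ + _).
  rewrite (kernel_op_sum _ c _ (spair k) bal); apply: eq_bigr => l _; exact: mulrC.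
have KD f r c x : bmeas f r -> kernel_op mu K (fun y => f y + 1 * \sum_l c l * al l y) x =
    kernel_op mu K f x + \sum_l c l * kernel_op mu K (al l) x.
  move=> bf; have bs : bmeas (fun y => \sum_l c l * al l y)
      (\sum_l `|c l| * (B0 * `|r0 l|)) by apply: bmeas_sum => l; exact: bmeasZ.
  rewrite (kernel_opD _ _ sK bf bs) mul1r; congr (_ + _).
  by rewrite (kernel_op_sum _ c _ sK bal).
have bD f r c : bmeas f r -> bmeas (fun y => f y + 1 * \sum_l c l * al l y)
    (r + \sum_l `|c l| * (B0 * `|r0 l|)).
  move=> bf; apply: bmeasD => //; rewrite -[X in bmeas _ X]mul1r -[X in X * _]normr1.
  by apply: bmeasZ; apply: bmeas_sum => l; exact: bmeasZ.
pose M := \matrix_(k, l) pair (b' k) (al l).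
pose Q := 1%:M - M.
have QE (c : 'cV_n) k : (Q *m c) k 0 =
    c k 0 - \sum_l pair (b' k) (al l) * c l 0.
  by rewrite mulmxBl mul1mx !mxE; congr (_ - _); apply: eq_bigr => l _; rewrite mxE.
have Qu : Q \in unitmx.
  rewrite unitmxE unitfE -det_tr; apply/negP => /det0P[v v0 vQ].
  case/eqP : v0; apply/rowP => k; rewrite mxE.
  have cE l : v 0 l = \sum_j pair (b' l) (al j) * v 0 j.
    apply/eqP; rewrite -subr_eq0; apply/eqP.
    have QvT : Q *m v^T = 0 by rewrite -[LHS]trmxK trmx_mul trmxK vQ trmx0.
    transitivity ((Q *m v^T) l 0); last by rewrite QvT mxE.
    by rewrite QE mxE; congr (_ - _); apply: eq_bigr => j _; rewrite mxE.
  pose f := fun y => cst 0 y + 1 * \sum_l v 0 l * al l y.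
  have b0 := @bmeas_cst _ T R 0.
  have bf := bD _ _ (v 0) b0.
  have pairf l : pair (b' l) f = v 0 l.
    rewrite (pairD _ _ _ _ b0) -cE /pair /kernel_op.
    by under eq_Rintegral do rewrite mulr0; rewrite Rintegral_cst// mul0r add0r.
  have ff x : f x = kernel_op mu (fun p => H1 p + H2 p) f x.
    rewrite (KF _ _ _ bf) (KD _ _ _ _ b0).
    rewrite [kernel_op mu K (cst 0) x](_ : _ = 0) ?add0r; last first.
      by rewrite /kernel_op; under eq_Rintegral do rewrite mulr0; rewrite Rintegral_cst// mul0r.
    rewrite -big_split/= /f add0r mul1r; apply: eq_bigr => l _.
    rewrite pairf -(hal l).2; ring.
  have f0 := inj _ _ bf ff.
  rewrite -pairf /pair /kernel_op /Rintegral.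
  rewrite (ae_eq_integral (cst 0%E)) ?integral0//.
    apply/measurable_EFinP; apply: measurable_funM; last by case: bf.
    by case: (hb k).
  apply: filterS f0 => y fy _; transitivity (b' k y * f y)%:E => //.
  by rewrite [f y]fy mulr0.
pose P := invmx Q.
pose D := B0 + \sum_l (\sum_k `|P l k| * (`|s0 k| * muT * B0)) * (B0 * `|r0 l|).
exists D.
  rewrite addr_ge0// sumr_ge0// => l _; rewrite mulr_ge0 ?mulr_ge0//.
  by rewrite sumr_ge0// => k _; rewrite !mulr_ge0.
move=> b r rge0 bb; have [be [bbe solbe]] := solve b r rge0 bb.
pose c := P *m \col_k pair (b' k) be.
have cE k : c k 0 = pair (b' k) be + \sum_l pair (b' k) (al l) * c l 0.
  apply/eqP; rewrite -subr_eq -QE /c /P mulmxA mulmxV// mul1mx mxE//.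
have bf := bD _ _ (fun l => c l 0) bbe.
exists (fun y => be y + 1 * \sum_l c l 0 * al l y); split.
  case: bf => mf fB; split => // x; apply: le_trans (fB x) _.
  rewrite /D mulrDl lerD2l mulr_suml ler_sum// => l _.
  rewrite [leRHS]mulrAC ler_wpM2r ?mulr_ge0//.
  rewrite /c mxE (le_trans (ler_norm_sum _ _ _))// mulr_suml ler_sum// => k _.
  rewrite normrM -[leRHS]mulrA ler_wpM2l// mxE.
  rewrite (_ : _ * r = `|s0 k| * muT * (B0 * r)); last by ring.
  exact: kernel_op_bound (spair k) bbe.
move=> x; rewrite (KF _ _ _ bf) (KD _ _ _ _ bbe) -solbe mul1r.
have -> : \sum_k pair (b' k) (fun y => be y + 1 * \sum_l c l 0 * al l y) * a k x =
    \sum_l c l 0 * al l x - \sum_l c l 0 * kernel_op mu K (al l) x.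
  rewrite -sumrB; apply: eq_bigr => k _; rewrite (pairD _ _ _ _ bbe) -cE -(hal k).2; ring.
ring.
Qed.

End fredholm.
(** * Systems of integral equations *)

Lemma measurable_select {d} {T : measurableType d} {R : realType}
    (q : T -> nat) (h : nat -> T -> R) :
  measurable_fun setT q -> (forall n, measurable_fun setT (h n)) ->
  measurable_fun setT (fun t => h (q t) t).
Proof.
move=> mq mh _ B mB; rewrite setTI.
rewrite (_ : _ @^-1` B = \bigcup_n (q @^-1` [set n] `&` h n @^-1` B)); last first.
  by apply/seteqP; split=> [t Bt|t [n _ [/= <-]]//]; exists (q t).
apply: bigcup_measurable => n _; apply: measurableI.
  by rewrite -[X in measurable X]setTI; exact: mq.
by rewrite -[X in measurable X]setTI; exact: mh.
Qed.

Section card_measure.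
Context {R : realType} (n : nat).

(** The counting measure of the naturals below n, which index the components. *)
Definition card_measure : set nat -> \bar R :=
  msum (fun i : nat => \d_i : {measure set nat -> \bar R}) n.

HB.instance Definition _ := Measure.on card_measure.

Let card_measure_fin : fin_num_fun card_measure.
Proof.
by move=> A _; rewrite /card_measure /msum; apply/sum_fin_numP => i _ _.
Qed.

HB.instance Definition _ := Measure_isFinite.Build _ _ _ card_measure card_measure_fin.

Lemma ge0_integral_card_measure (f : nat -> \bar R) : (forall i, (0 <= f i)%E) ->
  (\int[card_measure]_i f i = \sum_(i < n) f i)%E.
Proof.
move=> f0; rewrite ge0_integral_measure_sum//.
by apply: eq_bigr => i _; rewrite integral_dirac// diracE in_setT mul1e.
Qed.

End card_measure.

Section copies.
Context {d} {X : measurableType d} {R : realType}.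
Variable (mu : {finite_measure set X -> \bar R}) (n : nat).

Definition copies : set (X * nat) -> \bar R := (mu \x @card_measure R n)%E.

HB.instance Definition _ := Measure.on copies.

Let copies_fin : fin_num_fun copies.
Proof.
move=> A mA; rewrite ge0_fin_numE//.
apply: (@le_lt_trans _ _ (copies setT)); first by apply: le_measure; rewrite ?inE.
rewrite /copies -setXTT product_measure1E// lte_mul_pinfty//.
  by rewrite fin_num_measure.
by rewrite -ge0_fin_numE// fin_num_measure.
Qed.

HB.instance Definition _ := Measure_isFinite.Build _ _ _ copies copies_fin.

Lemma ge0_integral_copies (F : X * nat -> \bar R) : measurable_fun setT F ->
  (forall p, (0 <= F p)%E) ->
  (\int[copies]_p F p = \sum_(i < n) \int[mu]_x F (x, nat_of_ord i))%E.
Proof.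
move=> mF F0; rewrite /copies fubini_tonelli2// ge0_integral_card_measure//.
by move=> i; exact: integral_ge0.
Qed.

Lemma Rintegral_copies (F : X * nat -> R) : measurable_fun setT F ->
  (forall i, mu.-integrable setT (fun x => (F (x, i))%:E)) ->
  \int[copies]_p F p = \sum_(i < n) \int[mu]_x F (x, nat_of_ord i).
Proof.
move=> mF iF; have mF' : measurable_fun setT (EFin \o F) by exact/measurable_EFinP.
rewrite /Rintegral integralE !ge0_integral_copies//; last 2 first.
  exact: measurable_funeneg.
  exact: measurable_funepos.
have posE i : (fun x => (F (x, i))%:E)^\+%E = (fun x => (EFin \o F)^\+%E (x, i)).
  by apply/funext => x; rewrite !funeposE.
have negE i : (fun x => (F (x, i))%:E)^\-%E = (fun x => (EFin \o F)^\-%E (x, i)).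
  by apply/funext => x; rewrite !funenegE.
have fp i : (\int[mu]_x ((EFin \o F)^\+%E (x, i)))%E \is a fin_num.
  by rewrite -posE; exact: integrable_pos_fin_num (iF i).
have fn i : (\int[mu]_x ((EFin \o F)^\-%E (x, i)))%E \is a fin_num.
  by rewrite -negE; exact: integrable_neg_fin_num (iF i).
rewrite fineB; [|by apply/sum_fin_numP => i _ _|by apply/sum_fin_numP => i _ _].
rewrite -!sum_fine// -sumrB; apply: eq_bigr => i _.
by rewrite [in RHS]integralE posE negE [RHS]fineB; [|exact: fp|exact: fn].
Qed.

End copies.

Section fredholm_system.
Context {d} {X : measurableType d} {R : realType}.
Variable (mu : {finite_measure set X -> \bar R}) (n : nat).
Implicit Types H K : 'I_n.+1 -> 'I_n.+1 -> X * X -> R.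
Local Notation XN := (X * nat)%type.

(** Components are indexed by [nat]; [inord] sends every index above n to the
first component, and such indices are not charged by [card_measure]. *)
Definition scalar_kernel H (p : XN * XN) : R :=
  H (inord p.1.2) (inord p.2.2) (p.1.1, p.2.1).

Let measurable_inord_fst (f : 'I_n.+1 -> X -> R) :
  (forall i, measurable_fun setT (f i)) ->
  measurable_fun setT (fun p : XN => f (inord p.2) p.1).
Proof.
move=> mf.
apply: (measurable_select (q := snd) (h := fun i (p : XN) => f (inord i) p.1)) => // i.
exact: (measurableT_comp (mf _)).
Qed.

Lemma measurable_scalar_kernel H : (forall i j, measurable_fun setT (H i j)) ->
  measurable_fun setT (scalar_kernel H).
Proof.
move=> mH; apply: (measurable_select (q := fun p : XN * XN => p.1.2)
  (h := fun i (p : XN * XN) => H (inord i) (inord p.2.2) (p.1.1, p.2.1))).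
  exact: measurableT_comp.
move=> i; apply: (measurable_select (q := fun p : XN * XN => p.2.2)
  (h := fun j (p : XN * XN) => H (inord i) (inord j) (p.1.1, p.2.1))).
  exact: measurableT_comp.
move=> j; apply: (measurableT_comp (mH _ _)).
by apply: measurable_fun_pair; exact: measurableT_comp.
Qed.

Lemma scalar_kernel_schur H m :
  (forall i j, schur mu (H i j) m) ->
  schur (copies mu n.+1) (scalar_kernel H) (n.+1%:R * m).
Proof.
move=> sH; have mH i j : measurable_fun setT (H i j) by case: (sH i j).
have mS := measurable_scalar_kernel mH.
have m0 : 0 <= m by case: (sH ord0 ord0).
have sumE (F : XN -> R) : measurable_fun setT F ->
    (forall i : 'I_n.+1, (\int[mu]_x `|F (x, nat_of_ord i)|%:E <= m%:E)%E) ->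
    (\int[copies mu n.+1]_p `|F p|%:E <= (n.+1%:R * m)%:E)%E.
  move=> mF Fm; rewrite ge0_integral_copies//; last first.
    by apply/measurable_EFinP; exact: measurableT_comp.
  have -> : (n.+1%:R * m)%:E = (\sum_(i < n.+1) m%:E)%E.
    by rewrite sumEFin sumr_const card_ord mulr_natl.
  by apply: lee_sum => i _; exact: Fm.
split; first exact: mulr_ge0.
- exact: mS.
- move=> [x i]; apply: sumE; first exact: measurable_slice.
  by move=> j; rewrite /scalar_kernel/= inord_val; case: (sH (inord i) j).
- move=> [x i]; apply: sumE; first exact: measurable_slice2.
  by move=> j; rewrite /scalar_kernel/= inord_val; case: (sH j (inord i)).
Qed.

Lemma kernel_op_scalar_kernel H m (F : XN -> R) r x i : (forall i j, schur mu (H i j) m) ->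
  bmeas F r -> kernel_op (copies mu n.+1) (scalar_kernel H) F (x, i) =
  \sum_(j < n.+1) kernel_op mu (H (inord i) j) (fun y => F (y, nat_of_ord j)) x.
Proof.
move=> sH [mF Fr]; rewrite /kernel_op Rintegral_copies.
- apply: eq_bigr => j _; apply: eq_Rintegral => y _.
  by rewrite /scalar_kernel/= inord_val.
- apply: measurable_funM => //; apply: measurable_slice.
  by apply: measurable_scalar_kernel => a b; case: (sH a b).
move=> j; have bF : bmeas (fun y => F (y, j)) r.
  by split=> //; apply: (measurableT_comp mF); exact: measurable_pair2.
by have [] := schur_slice x (sH (inord i) (inord j)) bF.
Qed.

(** The bound (4 n.+1)^-1 on the entries gives 1/4 for the scalar kernel, as each
Schur integral runs over n.+1 components. *)
Theorem fredholm_system H1 H2 C : 0 < C ->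
  (forall i j, schur mu (H1 i j) (4 * n.+1%:R)^-1) ->
  (forall i j, measurable_fun setT (H2 i j)) ->
  (forall i j p, `|H2 i j p| <= C) ->
  (forall (f : 'I_n.+1 -> X -> R) r, (forall i, bmeas (f i) r) ->
    (forall i x, f i x = \sum_j kernel_op mu (fun p => H1 i j p + H2 i j p) (f j) x) ->
    forall i, {ae mu, forall x, f i x = 0}) ->
  exists2 B, 0 <= B & forall (b : 'I_n.+1 -> X -> R) r, 0 <= r ->
    (forall i, bmeas (b i) r) -> exists f : 'I_n.+1 -> X -> R,
    (forall i, bmeas (f i) (B * r)) /\ forall i x,
    f i x - \sum_j kernel_op mu (fun p => H1 i j p + H2 i j p) (f j) x = b i x.
Proof.
move=> C0 sH1 mH2 H2C inj.
have n0 : n.+1%:R != 0 :> R by rewrite pnatr_eq0.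
have s1 : schur (copies mu n.+1) (scalar_kernel H1) 4^-1.
  have -> : 4^-1 = n.+1%:R * (4 * n.+1%:R)^-1 :> R by field.
  exact: scalar_kernel_schur.
have m2 := measurable_scalar_kernel mH2.
pose H i j p := H1 i j p + H2 i j p.
have sH i j : schur mu (H i j) ((4 * n.+1%:R)^-1 + C * fine (mu setT)).
  by apply: schurD => //; apply: bounded_schur => //; exact: ltW.
have HE : (fun p => scalar_kernel H1 p + scalar_kernel H2 p) = scalar_kernel H by [].
have slice (F : XN -> R) r i : bmeas F r -> bmeas (fun y => F (y, i)) r.
  by move=> [mF Fr]; split=> //; apply: (measurableT_comp mF); exact: measurable_pair2.
have [|B B0 solve] := fredholm_alternative s1 m2 C0 (fun p => H2C _ _ _).
  move=> F r bF FE; rewrite HE in FE.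
  have f0 := inj (fun i x => F (x, nat_of_ord i)) r (fun i => slice F r i bF).
  have {}f0 (i : 'I_n.+1) : {ae mu, forall x, F (x, nat_of_ord i) = 0}.
    apply: f0 => {}i x; rewrite FE (kernel_op_scalar_kernel _ _ sH bF).
    by apply: eq_bigr => j _; rewrite inord_val.
  have [mF _] := bF.
  have mEF : measurable_fun setT (EFin \o F) by exact/measurable_EFinP.
  have : (\int[copies mu n.+1]_p `|(EFin \o F) p| = 0)%E.
    rewrite ge0_integral_copies//; last exact: measurableT_comp.
    apply: big1 => i _.
    have mFi : measurable_fun setT (fun x => (F (x, nat_of_ord i))%:E).
      by apply/measurable_EFinP; apply: (measurableT_comp mF); exact: measurable_pair2.
    apply/(ae_eq_integral_abs mu measurableT mFi).
    by apply: filterS (f0 i) => x /= ->.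
  move/(ae_eq_integral_abs (copies mu n.+1) measurableT mEF).
  by apply: filterS => p /(_ I) /= [].
exists B => // b r r0 bb.
have bF : bmeas (fun p : XN => b (inord p.2) p.1) r.
  split; first by apply: measurable_inord_fst => i; case: (bb i).
  by move=> p; case: (bb (inord p.2)).
have [F [bdF FE]] := solve _ _ r0 bF.
exists (fun i x => F (x, nat_of_ord i)); split; first by move=> i; exact: slice.
move=> i x; have := FE (x, nat_of_ord i); rewrite HE (kernel_op_scalar_kernel _ _ sH bdF)/=.
by rewrite inord_val.
Qed.

End fredholm_system.
(** * Vectors, boxes and Lebesgue measure *)

Section euclidean_norm.
Context {R : realType} {n : nat}.
Implicit Types (x y : 'cV[R]_n).

Lemma edotE x y : edot x y = \sum_i x i 0 * y i 0.
Proof. by rewrite /edot mxE; apply: eq_bigr => i _; rewrite mxE. Qed.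

Lemma edot_ge0 x : 0 <= edot x x.
Proof. by rewrite edotE sumr_ge0// => i _; rewrite -expr2 sqr_ge0. Qed.

Lemma edotC x y : edot x y = edot y x.
Proof. by rewrite !edotE; apply: eq_bigr => i _; rewrite mulrC. Qed.

Lemma enorm_ge0 x : 0 <= enorm x.
Proof. exact: sqrtr_ge0. Qed.

Lemma sqr_enorm x : enorm x ^+ 2 = edot x x.
Proof. by rewrite sqr_sqrtr// edot_ge0. Qed.

Lemma edotN x : edot (- x) (- x) = edot x x.
Proof. by rewrite !edotE; apply: eq_bigr => i _; rewrite !mxE mulrNN. Qed.

Lemma enormN x : enorm (- x) = enorm x.
Proof. by rewrite /enorm edotN. Qed.

Lemma le_entry_enorm x i : `|x i 0| <= enorm x.
Proof.
rewrite -(@ler_sqr R) ?nnegrE ?enorm_ge0 ?normr_ge0// sqr_enorm edotE (bigD1 i)//=.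
rewrite real_normK ?num_real// expr2 lerDl sumr_ge0// => j _.
by rewrite -expr2 sqr_ge0.
Qed.

Lemma enorm_le x c : (forall i, `|x i 0| <= c) -> 0 <= c -> enorm x <= n%:R * c.
Proof.
move=> xc c0; rewrite -(@ler_sqr R) ?nnegrE ?enorm_ge0 ?mulr_ge0// sqr_enorm edotE.
apply: (@le_trans _ _ (\sum_(i < n) c ^+ 2)).
  apply: ler_sum => i _; rewrite -expr2 -real_normK ?num_real//.
  by rewrite ler_sqr ?nnegrE.
rewrite sumr_const card_ord -[leLHS]mulr_natl exprMn ler_wpM2r ?sqr_ge0//.
by rewrite expr2 -natrM ler_nat; case: (n) => // k; rewrite leq_pmulr.
Qed.

Lemma enorm0_eq0 x : enorm x = 0 -> x = 0.
Proof.
move=> x0; apply/colP => i; rewrite mxE; apply/normr0_eq0/eqP.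
by rewrite eq_le normr_ge0 andbT -x0 le_entry_enorm.
Qed.

Lemma enorm0 : enorm (0 : 'cV[R]_n) = 0.
Proof. by rewrite /enorm edotE big1 ?sqrtr0// => i _; rewrite mxE mul0r. Qed.

Lemma edirC x y : edir x y = - edir y x.
Proof. by rewrite /edir -scalerN opprB -(opprB y x) enormN. Qed.

Lemma edir_le1 x y i : `|edir y x i 0| <= 1.
Proof.
rewrite /edir mxE normrM ger0_norm ?invr_ge0 ?enorm_ge0//.
have [->|n0] := eqVneq (enorm (y - x)) 0; first by rewrite invr0 mul0r.
by rewrite ler_pdivrMl ?mulr1 ?le_entry_enorm// lt_neqAle eq_sym n0 enorm_ge0.
Qed.

End euclidean_norm.

Lemma measurable_invr_ge0 {d} {T : measurableType d} {R : realType} (f : T -> R) :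
  measurable_fun setT f -> (forall x, 0 <= f x) -> measurable_fun setT (fun x => (f x)^-1).
Proof.
move=> mf f0; rewrite (_ : (fun _ => _) = (@powR R ^~ (-1)) \o f).
  by apply: measurableT_comp => //; exact: measurable_powR.
by apply/funext => x /=; rewrite powR_inv1.
Qed.

Lemma measurable_sqrtr_ge0 {d} {T : measurableType d} {R : realType} (f : T -> R) :
  measurable_fun setT f -> (forall x, 0 <= f x) ->
  measurable_fun setT (fun x => Num.sqrt (f x)).
Proof.
move=> mf f0; rewrite (_ : (fun _ => _) = (@powR R ^~ 2^-1) \o f).
  by apply: measurableT_comp => //; exact: measurable_powR.
by apply/funext => x /=; rewrite powR12_sqrt.
Qed.

Section measurable_vectors.
Context {d} {T : measurableType d} {R : realType} {n : nat}.
Implicit Types (D : set T) (f g : T -> 'cV[R]_n).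

Lemma measurable_entry D f i : measurable_fun D f ->
  measurable_fun D (fun x => f x i 0).
Proof. by move=> mf; exact: (measurableT_comp (measurable_mx_entry i 0) mf). Qed.

Lemma measurable_cV D f : measurable D ->
  (forall i, measurable_fun D (fun x => f x i 0)) -> measurable_fun D f.
Proof.
move=> mD mf; apply/measurable_fun_mxP => // i j.
by rewrite (ord1 j).
Qed.

Lemma measurable_edot D f g : measurable_fun D f -> measurable_fun D g ->
  measurable_fun D (fun x => edot (f x) (g x)).
Proof.
move=> mf mg; under eq_fun do rewrite edotE.
by apply: measurable_sum => i; apply: measurable_funM; exact: measurable_entry.
Qed.

Lemma measurable_subcV D f g : measurable D -> measurable_fun D f -> measurable_fun D g ->
  measurable_fun D (fun x => f x - g x).
Proof.
move=> mD mf mg; apply: measurable_cV => // i; under eq_fun do rewrite !mxE.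
by apply: measurable_funB; exact: measurable_entry.
Qed.

Lemma measurable_enorm f : measurable_fun setT f ->
  measurable_fun setT (fun x => enorm (f x)).
Proof.
move=> mf; apply: measurable_sqrtr_ge0; first exact: measurable_edot.
by move=> x; exact: edot_ge0.
Qed.

Lemma measurable_edir f g : measurable_fun setT f -> measurable_fun setT g ->
  measurable_fun setT (fun x => edir (f x) (g x)).
Proof.
move=> mf mg; have mfg := measurable_subcV measurableT mf mg.
apply: measurable_cV => // i; under eq_fun do rewrite mxE.
apply: measurable_funM; last exact: measurable_entry.
by apply: measurable_invr_ge0; [exact: measurable_enorm|move=> x; exact: enorm_ge0].
Qed.

End measurable_vectors.

Section lebesgue_space.
Context {R : realType} {n : nat}.
Local Notation X := 'cV[R]_n.
Implicit Types (x y : X) (A : set X).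

Definition box x (r : R) : set X := [set y | forall i, `[x i 0 - r, x i 0 + r]%classic (y i 0)].

Lemma measurable_box x r : measurable (box x r).
Proof.
rewrite (_ : box x r = \bigcap_(i in setT)
    [set y : X | `[x i 0 - r, x i 0 + r]%classic (y i 0)]); last first.
  by apply/seteqP; split=> [y yb i _|y yb i]; [exact: yb|exact: (yb i)].
apply: fin_bigcap_measurable => // i _.
rewrite -[X in measurable X]setTI.
exact: (@measurable_mx_entry _ (measurableTypeR R)).
Qed.

Lemma lebesgue_box x r : 0 <= r -> lebesgue_cV n (box x r) = ((2 * r) ^+ n)%:E.
Proof.
move=> r0.
rewrite (lebesgue_cV_box (A := fun i => `[x i 0 - r, x i 0 + r]%classic))//.
rewrite (eq_bigr (fun=> (2 * r)%:E)) => [|i _]; last first.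
  rewrite lebesgue_measure_itv/= lte_fin -EFinD; case: ltP => rr; congr EFin; lra.
by rewrite prodEFin prodr_const card_ord.
Qed.

(** An open set is a union of boxes with rational centre and radius 1 / (k + 1). *)
Lemma open_measurable_cV A : open A -> measurable A.
Proof.
move=> oA.
pose q2r (q : 'cV[rat]_n) : X := map_mx (@ratr R) q.
pose F (p : 'cV[rat]_n * nat) := if `[< box (q2r p.1) p.2.+1%:R^-1 `<=` A >]
  then box (q2r p.1) p.2.+1%:R^-1 else set0.
have -> : A = \bigcup_p F p.
  apply/seteqP; split=> [x Ax|x [p _]]; last first.
    by rewrite /F; case: asboolP => // h; exact: h.
  have /nbhs_ballP[e /= e0 eA] : nbhs x A by exact: open_nbhs_nbhs.
  have [k ke] : exists k : nat, (k.+1%:R^-1 : R) < e / 2.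
    have e20 : 0 < e / 2 by rewrite divr_gt0.
    by have [k _ /(_ k (leqnn k))] := near_infty_natSinv_lt (PosNum e20); exists k.
  have k0 : 0 < (k.+1%:R^-1 : R) by rewrite invr_gt0.
  have /choice[q qP] (i : 'I_n) : exists q : rat,
      ratr q \in `]x i 0 - k.+1%:R^-1, x i 0 + k.+1%:R^-1[.
    by apply: rat_in_itvoo; rewrite ltrBlDr -addrA ltrDl addr_gt0.
  exists (\col_i q i, k) => //; rewrite /F; case: asboolP => [_ i|].
    by have := qP i; rewrite /q2r !mxE /= !in_itv/=; set t := _^-1 => /andP[? ?];
      apply/andP; split; lra.
  case=> y yb; apply: eA; split => // i j; rewrite (ord1 j).
  have := yb i; have := qP i; rewrite /q2r /= !mxE !in_itv/=.
  move: ke; set t := _^-1 => ? /andP[? ?] /andP[? ?].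
  by rewrite /ball/= ltr_norml; apply/andP; split; lra.
apply: countable_bigcupT_measurable; first exact: countableP.
by move=> p; rewrite /F; case: asboolP => // _; exact: measurable_box.
Qed.

End lebesgue_space.
(** * Kernels with a pole on the diagonal *)

Section restricted_measure.
Context {d} {T : measurableType d} {R : realType}.
Variables (mu : {measure set T -> \bar R}) (D : set T).
Hypotheses (mD : measurable D) (Dfin : (mu D < +oo)%E).
Local Notation muD := (mfrestr mD Dfin).

Lemma integral_mfrestr_sub (f : T -> \bar R) :
  (\int[muD]_(x in D) f x = \int[mu]_(x in D) f x)%E.
Proof.
apply: eq_measure_integral => A mA AD.
by rewrite /= /mfrestr /mrestr setIidl.
Qed.

Lemma integral_mfrestr (f : T -> \bar R) : (forall x, ~ D x -> f x = 0%E) ->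
  (\int[muD]_x f x = \int[mu]_(x in D) f x)%E.
Proof.
move=> f0; rewrite -integral_mfrestr_sub [RHS]integral_mkcond.
apply: eq_integral => x _; rewrite patchE; case: ifPn => // /negP xD.
by apply: f0 => Dx; apply: xD; rewrite inE.
Qed.

Lemma Rintegral_mfrestr (f : T -> R) : (forall x, ~ D x -> f x = 0) ->
  \int[muD]_x f x = \int[mu]_(x in D) f x.
Proof. by move=> f0; rewrite /Rintegral integral_mfrestr// => x /f0 ->. Qed.

Lemma ae_mfrestr (P : T -> Prop) :
  {ae mu, forall x, D x -> P x} -> {ae muD, forall x, P x}.
Proof.
move=> [N [mN N0 PN]]; exists (N `|` ~` D); split.
- by apply: measurableU => //; exact: measurableC.
- rewrite /= /mfrestr /mrestr setIUl [~` D `&` D]setICl setU0.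
  by apply/eqP; rewrite eq_le measure_ge0 andbT -N0 le_measure ?inE//;
    exact: measurableI.
move=> x /= nP; have [Dx|nDx] := pselect (D x); [left|by right].
by apply: PN => /= DP; apply: nP; exact: DP.
Qed.

End restricted_measure.

Section singular_integral.
Context {R : realType} {n : nat}.
Local Notation X := 'cV[R]_n.
Local Notation leb := (@lebesgue_cV R n).

Lemma bounded_entry (A : set X) : [bounded x | x in A] ->
  exists2 M, 0 <= M & forall x i, A x -> `|x i 0| <= M.
Proof.
move=> [M [Mr MA]]; exists (`|M| + 2); first by rewrite addr_ge0.
move=> x i Ax; have := MA (`|M| + 1); rewrite ltr_pwDr// ?ler_norm// => /(_ isT x Ax)/= h.
have : ball (0 : X) (`|M| + 2) x.
  by rewrite mx_norm_ball /ball_/= sub0r normrN (le_lt_trans h)// ltrD2l ltr1n.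
by case=> _ /(_ i 0); rewrite /ball/= mxE sub0r normrN; exact: ltW.
Qed.

Lemma bounded_lebesgue_lty (A : set X) : measurable A ->
  [bounded x | x in A] -> (leb A < +oo)%E.
Proof.
move=> mA /bounded_entry[M M0 MA].
apply: (@le_lt_trans _ _ (leb (box 0 M))).
  apply: le_measure; rewrite ?inE//; first exact: measurable_box.
  by move=> x Ax i /=; rewrite in_itv/= mxE sub0r add0r -ler_norml; exact: MA.
by rewrite lebesgue_box// ltry.
Qed.

Lemma lebesgue_setT_gt0 : (0 < leb setT)%E.
Proof.
apply: (@lt_le_trans _ _ (leb (box 0 1))).
  by rewrite lebesgue_box// lte_fin exprn_gt0// mulr1.
by apply: le_measure; rewrite ?inE//; exact: measurable_box.
Qed.

(** The pole of the kernel, cut off at distance r from x.  It vanishes at x because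
0^-1 = 0. *)
Definition near_pole x r (y : X) : R :=
  if enorm (y - x) < r then (enorm (y - x))^-1 else 0.

Lemma near_poleC (x y : X) r : near_pole x r y = near_pole y r x.
Proof. by rewrite /near_pole -enormN opprB. Qed.

Lemma measurable_near_pole (x : X) r : measurable_fun setT (near_pole x r).
Proof.
have me : measurable_fun setT (fun y : X => enorm (y - x)).
  by apply: measurable_enorm; exact: measurable_subcV.
apply: measurable_fun_ifT => //; first exact: measurable_fun_ltr.
by apply: measurable_invr_ge0 => // y; exact: enorm_ge0.
Qed.

Lemma near_pole_ge0 (x : X) r y : 0 <= near_pole x r y.
Proof. by rewrite /near_pole; case: ifP => // _; rewrite invr_ge0 enorm_ge0. Qed.

Lemma dyadic_radius (t r : R) : 0 < t -> t < r -> exists j : nat,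
  r * 2^-1 ^+ j.+1 <= t /\ t < r * 2^-1 ^+ j.
Proof.
move=> t0 tr; have r0 : 0 < r by exact: lt_trans tr.
have [j0 hj0] : exists j : nat, r * 2^-1 ^+ j.+1 <= t.
  have : (fun j => r * 2^-1 ^+ j) @ \oo --> (0 : R).
    rewrite -[X in _ --> X](mulr0 r); apply: cvgMr.
    by apply: cvg_expr; rewrite ger0_norm// invf_lt1// ltr1n.
  move/cvgrPdist_le => /(_ _ t0)[j _ /(_ j.+1 (leqnSn j)) /=].
  by rewrite sub0r normrN => h; exists j; apply: le_trans h; exact: ler_norm.
have ex : exists j : nat, r * 2^-1 ^+ j.+1 <= t by exists j0.
exists (ex_minn ex); case: ex_minnP => j hj jmin; split => //.
case: j hj jmin => [_ _|j _ jmin]; first by rewrite expr0 mulr1.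
by rewrite ltNge; apply/negP => /jmin; rewrite ltnn.
Qed.

(** On the shell r 2^-(j+1) <= |y - x| < r 2^-j the integrand is at most
2^(j+1) / r, and the shell lies in a box of side 2 r 2^-j.  As n >= 2 and
r 2^-j <= 1, the contributions are dominated by 2^(n+1) r 2^-j. *)
Lemma singular_integral x r : (2 <= n)%N -> 0 < r <= 1 ->
  (\int[leb]_y (near_pole x r y)%:E <= (2 ^+ n.+2 * r)%:E)%E.
Proof.
move=> n2 /andP[r0 r1].
pose a j : R := (r * 2^-1 ^+ j.+1)^-1.
pose rj j : R := r * 2^-1 ^+ j.
have h0 j : 0 < 2^-1 ^+ j :> R by rewrite exprn_gt0.
have a0 j : 0 < a j by rewrite invr_gt0 mulr_gt0.
have rj0 j : 0 < rj j by rewrite mulr_gt0.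
have rj1 j : rj j <= 1.
  have h1 : 2^-1 ^+ j <= 1 :> R by rewrite exprn_ile1// invf_le1// ler1n.
  by apply: mulr_ile1 => //; exact: ltW.
pose h j (y : X) : \bar R := (a j * \1_(box x (rj j)) y)%:E.
have hpos j y : (0 <= h j y)%E by rewrite lee_fin mulr_ge0// ltW.
have mh j : measurable_fun setT (h j).
  apply/measurable_EFinP; apply: measurable_funM => //.
  by apply: measurable_indic; exact: measurable_box.
have mnp : measurable_fun setT (fun y => (near_pole x r y)%:E).
  by apply/measurable_EFinP; exact: measurable_near_pole.
apply: (@le_trans _ _ (\int[leb]_y (\sum_(0 <= j <oo) h j y))%E).
  apply: ge0_le_integral => //.
  - by move=> y _; rewrite lee_fin near_pole_ge0.
  - by apply: ge0_emeasurable_sum.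
  move=> y _; rewrite /near_pole; case: ifPn => [yr|_]; last exact: nneseries_ge0.
  have [e0|e0] := eqVneq (enorm (y - x)) 0.
    by rewrite e0 invr0; exact: nneseries_ge0.
  have t0 : 0 < enorm (y - x) by rewrite lt_neqAle eq_sym e0 enorm_ge0.
  have [j [j1 j2]] := dyadic_radius t0 yr.
  apply: (@le_trans _ _ (h j y)).
    rewrite lee_fin indicE mem_set ?mulr1.
      by rewrite /a lef_pV2 ?posrE// mulr_gt0.
    move=> i /=; rewrite in_itv/=.
    have := le_entry_enorm (y - x) i; rewrite !mxE ler_norml /rj => /andP[? ?].
    by apply/andP; split; lra.
  apply: le_trans (nneseries_lim_ge j.+1 _); last by [].
  rewrite big_nat_recr//= leeDr//; exact: sume_ge0.
rewrite integral_nneseries//.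
(* a_j (2 r_j)^n <= a_j 2^n r_j^2, which is where n >= 2 enters *)
have hint j : (\int[leb]_y h j y <= (2 ^+ n.+1 * r * 2^-1 ^+ j)%:E)%E.
  rewrite /h; under eq_integral do rewrite EFinM.
  rewrite ge0_integralZl_EFin//; last 2 first.
  - by apply/measurable_EFinP; apply: measurable_indic; exact: measurable_box.
  - exact: ltW.
  rewrite integral_indic//; last exact: measurable_box.
  rewrite setIT [X in (_ * X)%E](lebesgue_box x (ltW (rj0 j))) -EFinM lee_fin exprMn.
  have rn : rj j ^+ n <= rj j ^+ 2.
    by apply: ler_wiXn2l => //; exact: ltW.
  apply: (@le_trans _ _ (a j * (2 ^+ n * rj j ^+ 2))).
    by rewrite ler_pM2l// ler_pM2l// exprn_gt0.
  rewrite le_eqVlt; apply/orP; left; apply/eqP; rewrite /a /rj !exprS.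
  by field; rewrite !gt_eqF.
apply: lime_le; first by apply: is_cvg_nneseries => j _ _; exact: integral_ge0.
apply: nearW => N.
apply: (@le_trans _ _ (\sum_(0 <= j < N) (2 ^+ n.+1 * r * 2^-1 ^+ j)%:E)%E).
  by apply: lee_sum => j _.
rewrite sumEFin lee_fin -mulr_sumr.
have -> : \sum_(0 <= j < N) 2^-1 ^+ j = 2 - 2 * 2^-1 ^+ N :> R.
  elim: N => [|N IHN]; first by rewrite big_geq// expr0; ring.
  by rewrite big_nat_recr//= IHN exprS; field.
rewrite [leRHS](_ : _ = 2 ^+ n.+1 * r * 2); last by rewrite exprSr; ring.
rewrite ler_pM2l; last by rewrite mulr_gt0// exprn_gt0.
by rewrite gerBl mulr_ge0// ltW.
Qed.

End singular_integral.
Section extension_by_zero.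
Context {d} {T : measurableType d} {R : realType} {n : nat} (D : set T).
Implicit Types f : T -> 'cV[R]_n.

Definition zext f x : 'cV[R]_n := \col_i ((fun y => f y i 0) \_ D) x.

Lemma zext_in f x : D x -> zext f x = f x.
Proof. by move=> Dx; apply/colP => i; rewrite mxE patchE mem_set. Qed.

Lemma zext_out f x : ~ D x -> zext f x = 0.
Proof. by move=> nDx; apply/colP => i; rewrite !mxE patchE memNset. Qed.

Lemma measurable_zext f : measurable D -> measurable_fun D f ->
  measurable_fun setT (zext f).
Proof.
move=> mD mf; apply: measurable_cV => // i; under eq_fun do rewrite mxE.
by apply/(measurable_restrictT _ mD); exact: measurable_entry.
Qed.

End extension_by_zero.

Section pole_kernels.
Context {R : realType} {n : nat} (Omega : set 'cV[R]_n).
Hypotheses (mO : measurable Omega) (Ofin : (lebesgue_cV n Omega < +oo)%E).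
Local Notation X := 'cV[R]_n.
Local Notation leb := (@lebesgue_cV R n).
Local Notation lebO := (mfrestr mO Ofin).

Definition supported (S : X * X -> R) :=
  forall x y, ~ Omega x \/ ~ Omega y -> S (x, y) = 0.

Lemma pole_schur (S : X * X -> R) C r : (2 <= n)%N -> 0 < r <= 1 ->
  measurable_fun setT S -> supported S ->
  0 <= C -> (forall p, `|S p| <= C * near_pole p.1 r p.2) ->
  schur lebO S (C * (2 ^+ n.+2 * r)).
Proof.
move=> n2 r01 mS S0 C0 SC.
have bound (f : X -> R) x : measurable_fun setT f -> (forall y, ~ Omega y -> f y = 0) ->
    (forall y, `|f y| <= C * near_pole x r y) ->
    (\int[lebO]_y `|f y|%:E <= (C * (2 ^+ n.+2 * r))%:E)%E.
  move=> mf f0 fC; rewrite integral_mfrestr => [|y /f0 ->]; last by rewrite normr0.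
  have mabs : measurable_fun setT (fun y => (`|f y|)%:E).
    by apply/measurable_EFinP; exact: measurableT_comp.
  have mn := measurable_near_pole x r.
  apply: (@le_trans _ _ (\int[leb]_y `|f y|%:E)%E).
    exact: ge0_subset_integral.
  apply: (@le_trans _ _ (\int[leb]_y (C%:E * (near_pole x r y)%:E))%E).
    apply: ge0_le_integral => //.
      by apply: emeasurable_funM => //; exact/measurable_EFinP.
    by move=> y _; rewrite -EFinM lee_fin.
  rewrite ge0_integralZl_EFin//; last 2 first.
  - by move=> y _; rewrite lee_fin near_pole_ge0.
  - exact/measurable_EFinP.
  by rewrite EFinM lee_wpmul2l ?lee_fin//; exact: singular_integral.
split => //.
- case/andP: r01 => r0 _; apply: mulr_ge0 => //.
  by apply: mulr_ge0; [exact: exprn_ge0|exact: ltW].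
- move=> x; apply: (bound _ x); first exact: measurable_slice.
    by move=> y yO; rewrite S0//; right.
  by move=> y; exact: SC.
- move=> y; apply: (bound _ y); first exact: measurable_slice2.
    by move=> x xO; rewrite S0//; left.
  by move=> x; rewrite near_poleC; exact: SC.
Qed.

End pole_kernels.

(** * The bond kernel *)

Section bond_kernel.
Context {R : realType} {n : nat} (Omega : set 'cV[R]_n).
Context (eps : R) (J g : R -> R) (u : 'cV[R]_n -> 'cV[R]_n).
Local Notation X := 'cV[R]_n.

Definition bond_kernel (p : X * X) : R :=
  \1_Omega p.1 * \1_Omega p.2 *
  (if enorm (p.2 - p.1) < eps then
     weight eps J p.2 p.1 / enorm (p.2 - p.1) * bond_stiffness g u p.2 p.1
   else 0).

(** The matrix c e e^T of the linearization, one entry at a time.  The kernel is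
cut off outside Omega x Omega so that all integrals can be taken over the whole
space. *)
Definition bond_matrix (i j : 'I_n) (p : X * X) : R :=
  bond_kernel p * (edir p.2 p.1 i 0 * edir p.2 p.1 j 0).

Lemma bond_kernel_supported x y : ~ Omega x \/ ~ Omega y -> bond_kernel (x, y) = 0.
Proof.
by rewrite /bond_kernel !indicE /= => -[nO|nO]; rewrite (memNset nO) ?mulr0 !mul0r.
Qed.

Lemma bond_matrix_supported i j : supported Omega (bond_matrix i j).
Proof. by move=> x y /bond_kernel_supported xy; rewrite /bond_matrix xy mul0r. Qed.

Lemma weightC (x y : X) : weight eps J x y = weight eps J y x.
Proof. by rewrite /weight -enormN opprB. Qed.

Lemma bond_stiffnessC (x y : X) : bond_stiffness g u x y = bond_stiffness g u y x.
Proof.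
rewrite /bond_stiffness /strain edirC -enormN opprB; congr (derive1n _ _ (_ * _)).
rewrite !edotE; apply: eq_bigr => i _; rewrite !mxE.
by ring.
Qed.

Lemma bond_kernelC x y : bond_kernel (x, y) = bond_kernel (y, x).
Proof.
rewrite /bond_kernel/= [\1__ x * _]mulrC -(enormN (y - x)) opprB.
by rewrite weightC bond_stiffnessC.
Qed.

Lemma bond_matrixC i j x y : bond_matrix i j (x, y) = bond_matrix i j (y, x).
Proof. by rewrite /bond_matrix bond_kernelC/= edirC !mxE mulrNN. Qed.

Hypotheses (mO : measurable Omega) (Ofin : (lebesgue_cV n Omega < +oo)%E).
Hypotheses (mJ : measurable_fun setT J) (Jb : exists M, forall r, `|J r| <= M).
Hypotheses (mg : measurable_fun setT (derive1n 2 g))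
  (gb : exists M, forall r, `|derive1n 2 g r| <= M).
Hypothesis mu : measurable_fun Omega u.
Local Notation leb := (@lebesgue_cV R n).
Local Notation lebO := (mfrestr mO Ofin).

Lemma measurable_bond_kernel : measurable_fun setT bond_kernel.
Proof.
pose v := zext Omega u.
have mv : measurable_fun setT v by exact: measurable_zext.
have -> : bond_kernel = fun p : X * X => \1_Omega p.1 * \1_Omega p.2 *
  (if enorm (p.2 - p.1) < eps then
     weight eps J p.2 p.1 / enorm (p.2 - p.1) * bond_stiffness g v p.2 p.1
   else 0).
  apply/funext => -[x y].
  have [[xO yO]|nO] := pselect (Omega x /\ Omega y).
    by rewrite /bond_kernel/bond_stiffness /strain /v /= (zext_in _ xO) (zext_in _ yO).
  have out (q : R) : \1_Omega x * \1_Omega y * q = 0.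
    have [nx|ny] : ~ Omega x \/ ~ Omega y by apply/not_andP.
      by rewrite indicE (memNset nx) mul0r mul0r.
    by rewrite mulrC [X in _ * (_ * X)]indicE (memNset ny) mulr0 mulr0.
  by rewrite /bond_kernel /=; rewrite [LHS]out [RHS]out.
clearbody v.
have m1 : measurable_fun setT (fst : X * X -> X) by exact: measurable_fst.
have m2 : measurable_fun setT (snd : X * X -> X) by exact: measurable_snd.
have me : measurable_fun setT (fun p : X * X => enorm (p.2 - p.1)).
  by apply: measurable_enorm; exact: measurable_subcV.
have mei : measurable_fun setT (fun p : X * X => (enorm (p.2 - p.1))^-1).
  by apply: measurable_invr_ge0 => // p; exact: enorm_ge0.
apply: measurable_funM.
  apply: measurable_funM.
    by apply: measurableT_comp => //; exact: measurable_indic.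
  by apply: measurableT_comp => //; exact: measurable_indic.
apply: measurable_fun_ifT => //; first exact: measurable_fun_ltr.
apply: measurable_funM.
  apply: measurable_funM => //; rewrite /weight; apply: measurable_funM => //.
  by apply: measurableT_comp => //; exact: measurable_funM.
rewrite /bond_stiffness; apply: measurableT_comp => //.
apply: measurable_funM.
  by apply: measurable_sqrtr_ge0 => // p; exact: enorm_ge0.
apply: measurable_edot; last exact: measurable_edir.
apply: measurable_cV => // i; under eq_fun do rewrite !mxE.
apply: measurable_funM => //; apply: measurable_funB.
  exact: (measurable_entry i (measurableT_comp mv m2)).
exact: (measurable_entry i (measurableT_comp mv m1)).
Qed.

Lemma measurable_bond_matrix i j : measurable_fun setT (bond_matrix i j).
Proof.
have me : measurable_fun setT (fun p : X * X => edir p.2 p.1).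
  by apply: measurable_edir; [exact: measurable_snd|exact: measurable_fst].
apply: measurable_funM; first exact: measurable_bond_kernel.
by apply: measurable_funM; [exact: (measurable_entry i me)|exact: (measurable_entry j me)].
Qed.

Lemma bond_matrix_bound : exists2 C, 0 <= C & forall i j p,
  `|bond_matrix i j p| <= C * (enorm (p.2 - p.1))^-1.
Proof.
have [MJ JM] := Jb; have [Mg gM] := gb.
pose W := `|(eps ^+ n.+1 * unit_ball_volume (R := R) (d := n))^-1|.
have MJ0 : 0 <= MJ by rewrite (le_trans _ (JM 0)).
have Mg0 : 0 <= Mg by rewrite (le_trans _ (gM 0)).
have W0 : 0 <= W by exact: normr_ge0.
have JW0 : 0 <= MJ * W by exact: mulr_ge0.
exists (MJ * W * Mg); first exact: mulr_ge0.
move=> i j p; rewrite /bond_matrix normrM.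
have e1 : `|edir p.2 p.1 i 0 * edir p.2 p.1 j 0| <= 1.
  by rewrite normrM; apply: mulr_ile1 => //; exact: edir_le1.
have ei0 : 0 <= (enorm (p.2 - p.1))^-1 by rewrite invr_ge0 enorm_ge0.
rewrite -[leRHS]mulr1; apply: ler_pM => //.
rewrite /bond_kernel normrM -[leRHS]mul1r; apply: ler_pM => //.
  rewrite !indicE; case: (_ \in _); case: (_ \in _) => /=;
    by rewrite ?mulr0 ?mulr1 ?normr0 ?normr1.
case: ifP => _; last by rewrite normr0; apply: mulr_ge0 => //; exact: mulr_ge0.
rewrite normrM [leRHS]mulrAC; apply: ler_pM => //; last exact: gM.
rewrite normrM (ger0_norm ei0); apply: ler_wpM2r => //.
by rewrite /weight normrM; exact: ler_wpM2r.
Qed.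

(** The part at distance less than 1 is controlled by the pole, the rest is
bounded. *)
Lemma bond_matrix_schur : (2 <= n)%N ->
  exists m, forall i j, schur lebO (bond_matrix i j) m.
Proof.
move=> n2; have [C C0 bC] := bond_matrix_bound.
pose N i j p := if enorm (p.2 - p.1) < 1 then bond_matrix i j p else 0.
pose F i j p := if enorm (p.2 - p.1) < 1 then 0 else bond_matrix i j p.
have me : measurable_fun setT (fun p : X * X => enorm (p.2 - p.1)).
  by apply: measurable_enorm; exact: measurable_subcV.
have NF i j : bond_matrix i j = fun p => N i j p + F i j p.
  by apply/funext => p; rewrite /N /F; case: ifP; rewrite ?addr0 ?add0r.
have sN i j : schur lebO (N i j) (C * (2 ^+ n.+2 * 1)).
  apply: pole_schur => //; first by rewrite ltr01 lexx.
  - apply: measurable_fun_ifT => //; first exact: measurable_fun_ltr.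
    exact: measurable_bond_matrix.
  - by move=> x y xy; rewrite /N bond_matrix_supported// if_same.
  - move=> p; rewrite /N /near_pole; case: ifP => _; first exact: bC.
    by rewrite normr0 mulr0.
have sF i j : schur lebO (F i j) (C * fine (lebO setT)).
  apply: bounded_schur => //.
    apply: measurable_fun_ifT => //; first exact: measurable_fun_ltr.
    exact: measurable_bond_matrix.
  move=> p; rewrite /F; case: ifPn => [_|]; first by rewrite normr0.
  rewrite -leNgt => e1; apply: le_trans (bC i j p) _.
  rewrite -[leRHS]mulr1 ler_wpM2l// invf_le1// (lt_le_trans _ e1)//.
exists (C * (2 ^+ n.+2 * 1) + C * fine (lebO setT)) => i j.
by rewrite NF; exact: schurD.
Qed.

End bond_kernel.
(** * The linearization as an operator on bounded vector fields *)

Lemma Rintegral_sum {d} {T : measurableType d} {R : realType}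
    (mu : {measure set T -> \bar R}) (I : Type) (s : seq I) (F : I -> T -> R) :
  (forall i, mu.-integrable setT (EFin \o F i)) ->
  \int[mu]_x (\sum_(i <- s) F i x) = \sum_(i <- s) \int[mu]_x F i x.
Proof.
move=> iF; elim: s => [|i s IHs].
  rewrite big_nil; under eq_Rintegral do rewrite big_nil.
  by rewrite Rintegral_cst// mul0r.
rewrite big_cons -IHs -RintegralD//.
  by apply: eq_Rintegral => x _; rewrite big_cons.
have := @integrable_sum _ _ _ mu setT measurableT _ s xpredT (fun i => EFin \o F i)
  (fun i _ => iF i).
by apply: eq_integrable => // x _; rewrite /= sumEFin.
Qed.

Section symmetric_kernel.
Context {d} {T : measurableType d} {R : realType}.
Variable mu : {finite_measure set T -> \bar R}.

Lemma kernel_op_symmetric (H : T * T -> R) m f g r s :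
  schur mu H m -> (forall x y, H (x, y) = H (y, x)) -> bmeas f r -> bmeas g s ->
  \int[mu]_x (kernel_op mu H f x * g x) = \int[mu]_x (f x * kernel_op mu H g x).
Proof.
move=> sH Hsym bf bg; have [m0 mH Hm _] := sH.
pose G p := H p * f p.2 * g p.1.
have mG : measurable_fun setT G.
  have [mf _] := bf; have [mg _] := bg.
  apply: measurable_funM; last exact: measurableT_comp.
  exact: measurable_kernelM.
have iG : (mu \x mu)%E.-integrable setT (EFin \o G).
  apply/integrable12ltyP; first exact/measurable_EFinP.
  apply: (@le_lt_trans _ _ (\int[mu]_x `|m * r * s|%:E)%E).
    apply: ge0_le_integral => //=.
    - by move=> x _; exact: integral_ge0.
    - apply: (@measurable_fun_fubini_tonelli_F _ _ _ _ _ mu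
        (fun p => (`|G p|)%:E)) => //.
      by apply/measurable_EFinP; exact: measurableT_comp.
    - move=> x _; have [int le] := schur_slice x sH bf; have [_ gs] := bg.
      rewrite /G/=; under eq_integral do rewrite normrM EFinM.
      rewrite ge0_integralZr//; last first.
        case/integrableP : int => /measurable_EFinP mi _.
        by apply/measurable_EFinP; exact: measurableT_comp.
      apply: (@le_trans _ _ ((m * r)%:E * s%:E)%E).
        by apply: lee_pmul; [exact: integral_ge0|rewrite lee_fin|exact: le|rewrite lee_fin].
      by rewrite -EFinM lee_fin ler_norm.
  rewrite integral_cst// lte_mul_pinfty//.
  by rewrite -ge0_fin_numE// fin_num_measure.
have := Fubini iG => /(congr1 fine).
have -> : (\int[mu]_x \int[mu]_y (EFin \o G) (x, y) =
    \int[mu]_x (kernel_op mu H f x * g x)%:E)%E.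
  apply: eq_integral => x _; have [int _] := schur_slice x sH bf.
  rewrite EFinM /kernel_op /Rintegral fineK; last exact: integrable_fin_num.
  rewrite -integralZr//; by apply: eq_integral => y _; rewrite /= /G -EFinM.
have -> : (\int[mu]_y \int[mu]_x (EFin \o G) (x, y) =
    \int[mu]_y (f y * kernel_op mu H g y)%:E)%E.
  apply: eq_integral => y _; have [int _] := schur_slice y sH bg.
  rewrite EFinM /kernel_op /Rintegral fineK; last exact: integrable_fin_num.
  rewrite -integralZl//; apply: eq_integral => x _.
  by rewrite /= /G -EFinM Hsym; congr EFin; ring.
by [].
Qed.

End symmetric_kernel.

Section linearization_operator.
Context {R : realType} {n : nat} (Omega : set 'cV[R]_n).
Context (eps : R) (J g : R -> R) (u : 'cV[R]_n -> 'cV[R]_n).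
Hypotheses (mO : measurable Omega) (Ofin : (lebesgue_cV n Omega < +oo)%E).
Local Notation X := 'cV[R]_n.
Local Notation leb := (@lebesgue_cV R n).
Local Notation lebO := (mfrestr mO Ofin).
Local Notation k := (bond_matrix Omega eps J g u).
Local Notation L := (linearization Omega eps J g u).
Local Notation A := (stability_tensor Omega eps J g u).

Definition bfield (f : X -> X) r := forall i, bmeas (fun x => f x i 0) r.

Lemma stability_tensorE x i j : Omega x -> A x i j = kernel_op lebO (k i j) (cst 1) x.
Proof.
move=> Ox; rewrite mxE /kernel_op; under [RHS]eq_Rintegral do rewrite /= mulr1.
rewrite Rintegral_mfrestr; last first.
  by move=> y nO; rewrite bond_matrix_supported//; right.
rewrite Rintegral_mkcondl; apply: eq_Rintegral => y /set_mem Oy.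
rewrite patchE /bond_matrix /bond_kernel /= !indicE (mem_set Ox) (mem_set Oy) mul1r.
case: ifPn => [|/negP] ye.
  rewrite (_ : enorm (y - x) < eps) ?mulr1; last by move: ye; rewrite inE.
  by rewrite !mxE big_ord1 !mxE mul1r.
rewrite (_ : (enorm (y - x) < eps) = false); last first.
  by apply/negP => h; apply: ye; rewrite inE.
by rewrite mulr0 mul0r.
Qed.

Lemma linearization_entry w x i : Omega x ->
  L w x i 0 = - \int[leb]_(y in Omega) \sum_j k i j (x, y) * (w y j 0 - w x j 0).
Proof.
move=> Ox; rewrite !mxE; congr (- _).
rewrite Rintegral_mkcondl; apply: eq_Rintegral => y /set_mem Oy.
rewrite patchE /bond_matrix /bond_kernel /= !indicE (mem_set Ox) (mem_set Oy) mul1r.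
case: ifPn => [|/negP] ye.
  rewrite (_ : enorm (y - x) < eps); last by move: ye; rewrite inE.
  rewrite mxE /strain edotE mulr_sumr mulr_suml; apply: eq_bigr => j _.
  by rewrite !mxE mul1r; ring.
rewrite (_ : (enorm (y - x) < eps) = false); last first.
  by apply/negP => h; apply: ye; rewrite inE.
by rewrite big1// => j _; rewrite mulr0 !mul0r.
Qed.

End linearization_operator.
Lemma bmeas_kernel_op {d} {T : measurableType d} {R : realType}
    (mu : {finite_measure set T -> \bar R}) (H : T * T -> R) m f r :
  schur mu H m -> bmeas f r -> bmeas (kernel_op mu H f) (m * r).
Proof.
move=> sH bf; split; first exact: measurable_kernel_op sH bf.
by move=> x; exact: kernel_op_bound sH bf.
Qed.

Section vector_operator.
Context {R : realType} {n : nat} (Omega : set 'cV[R]_n).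
Context (eps : R) (J g : R -> R) (u : 'cV[R]_n -> 'cV[R]_n).
Hypotheses (mO : measurable Omega) (Ofin : (lebesgue_cV n Omega < +oo)%E).
Local Notation X := 'cV[R]_n.
Local Notation leb := (@lebesgue_cV R n).
Local Notation lebO := (mfrestr mO Ofin).
Local Notation k := (bond_matrix Omega eps J g u).
Local Notation L := (linearization Omega eps J g u).
Local Notation A := (stability_tensor Omega eps J g u).
Variable m : R.
Hypothesis sk : forall i j, schur lebO (k i j) m.

(** The operator f |-> A f - K f.  It agrees with the linearization on Omega when f
is bounded everywhere; extended by 0, it is measurable on the whole space. *)
Definition linear_op (f : X -> X) : X -> X := fun x => \col_i \sum_j
  (kernel_op lebO (k i j) (cst 1) x * f x j 0 - kernel_op lebO (k i j) (fun y => f y j 0) x).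

Lemma linear_opE f x i : linear_op f x i 0 = \sum_j
  (kernel_op lebO (k i j) (cst 1) x * f x j 0 - kernel_op lebO (k i j) (fun y => f y j 0) x).
Proof. by rewrite mxE. Qed.

Let b1 : bmeas (cst 1 : X -> R) 1.
Proof. by split=> // x; rewrite normr1. Qed.

Lemma bfield_linear_op f r : bfield f r -> bfield (linear_op f) (\sum_(j < n) (m * 1 * r + m * r)).
Proof.
move=> bf i; under eq_fun do rewrite linear_opE.
have := @bmeas_sum _ X R 'I_n (index_enum _) (fun j x => kernel_op lebO (k i j) (cst 1) x *
  f x j 0 + -1 * kernel_op lebO (k i j) (fun y => f y j 0) x)
  (fun=> m * 1 * r + `|-1| * (m * r)).
rewrite normrN1 mul1r; under eq_fun do under eq_bigr do rewrite mulN1r; apply=> j.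
apply: bmeasD; first exact: bmeasM (bmeas_kernel_op (sk i j) b1) (bf j).
have := bmeasZ (-1) (bmeas_kernel_op (sk i j) (bf j)); rewrite normrN1 mul1r.
by under eq_fun do rewrite mulN1r.
Qed.

Lemma kernel_op_out i j h x : ~ Omega x -> kernel_op lebO (k i j) h x = 0.
Proof.
move=> nO; rewrite /kernel_op; under eq_Rintegral.
  by move=> y _; rewrite bond_matrix_supported ?mul0r; [over|left].
by rewrite Rintegral_cst// mul0r.
Qed.

Lemma linear_op_out f x : ~ Omega x -> linear_op f x = 0.
Proof.
move=> nO; apply/colP => i; rewrite linear_opE mxE big1// => j _.
by rewrite !kernel_op_out// mul0r subr0.
Qed.

(** The integral sees f only up to null sets, but L f(x) also involves the value
f(x) itself; the last term corrects it at the exceptional points. *)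
Lemma linearization_ae (f f' : X -> X) r x : measurable_fun Omega f -> bfield f' r ->
  {ae leb, forall y, Omega y -> f y = f' y} -> Omega x ->
  L f x = linear_op f' x + A x *m (f x - f' x).
Proof.
move=> mf bf' ff' Ox; apply/colP => i; rewrite linearization_entry//.
have mk j : measurable_fun setT (fun y => k i j (x, y)).
  by apply: measurable_slice; case: (sk i j).
pose G (h : X -> X) y := \sum_j k i j (x, y) * (h y j 0 - f x j 0).
have mG (h : X -> X) : measurable_fun Omega h -> measurable_fun Omega (G h).
  move=> mh; apply: measurable_sum => j; apply: measurable_funM.
    exact: measurable_funS (mk j).
  by apply: measurable_funB => //; exact: measurable_entry.
have mf' : measurable_fun Omega f'.
  apply: measurable_cV => // j; have [mfj _] := bf' j.
  exact: measurable_funS mfj.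
have -> : \int[leb]_(y in Omega) G f y = \int[leb]_(y in Omega) G f' y.
  rewrite /Rintegral; congr fine; apply: ae_eq_integral => //.
  - by apply/measurable_EFinP; exact: mG.
  - by apply/measurable_EFinP; exact: mG.
  - by apply: filterS ff' => y fy Oy; rewrite /G fy.
rewrite -(Rintegral_mfrestr mO Ofin); last first.
  move=> y nO; rewrite /G big1// => j _.
  by rewrite bond_matrix_supported ?mul0r//; right.
have int1 j : lebO.-integrable setT (EFin \o (fun y => k i j (x, y) * f' y j 0)).
  by case: (schur_slice x (sk i j) (bf' j)).
have int2 j : lebO.-integrable setT (EFin \o (fun y => k i j (x, y) * cst (f x j 0) y)).
  by case: (schur_slice x (sk i j) (bmeas_cst (f x j 0))).
rewrite /G; under eq_Rintegral do under eq_bigr do rewrite mulrBr.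
rewrite Rintegral_sum; last by move=> j; exact: (integrableB measurableT (int1 j) (int2 j)).
rewrite !mxE -sumrN -big_split/=; apply: eq_bigr => j _.
rewrite (RintegralB measurableT (int1 j) (int2 j)).
have -> : \int[lebO]_y (k i j (x, y) * cst (f x j 0) y) =
    kernel_op lebO (k i j) (cst 1) x * f x j 0.
  have [int3 _] := schur_slice x (sk i j) b1.
  by rewrite /kernel_op -RintegralZr//; apply: eq_Rintegral => y _; rewrite /= mulr1.
rewrite (stability_tensorE eps J g u mO Ofin i j Ox) !mxE /kernel_op; ring.
Qed.

Lemma linearization_bounded f r x : bfield f r -> Omega x -> L f x = linear_op f x.
Proof.
move=> bf Ox; rewrite (linearization_ae _ bf _ Ox).
- by rewrite subrr mulmx0 addr0.
- apply: measurable_cV => // j; have [mfj _] := bf j; exact: measurable_funS mfj.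
- exact: aeW.
Qed.

Definition field_dot (f h : X -> X) : R := \sum_i \int[lebO]_x (f x i 0 * h x i 0).

Lemma bmeas_int (f : X -> R) r : bmeas f r -> lebO.-integrable setT (EFin \o f).
Proof. exact: bmeas_integrable. Qed.

Lemma bond_matrix_tr i j : k i j = k j i.
Proof. by apply/funext => p; rewrite /bond_matrix [edir _ _ i 0 * _]mulrC. Qed.

Lemma field_dot_linear_op f h r s : bfield f r -> bfield h s ->
  field_dot (linear_op f) h = \sum_i \sum_j
    (\int[lebO]_x (kernel_op lebO (k i j) (cst 1) x * f x j 0 * h x i 0)
    - \int[lebO]_x (kernel_op lebO (k i j) (fun y => f y j 0) x * h x i 0)).
Proof.
move=> bf bh; apply: eq_bigr => i _.
have i1 j := bmeas_int (bmeasM (bmeasM (bmeas_kernel_op (sk i j) b1) (bf j)) (bh i)).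
have i2 j := bmeas_int (bmeasM (bmeas_kernel_op (sk i j) (bf j)) (bh i)).
under eq_Rintegral do rewrite linear_opE mulr_suml; rewrite Rintegral_sum.
  apply: eq_bigr => j _; rewrite -(RintegralB measurableT (i1 j) (i2 j)).
  by apply: eq_Rintegral => x _; rewrite mulrBl.
move=> j; have := integrableB measurableT (i1 j) (i2 j).
by apply: eq_integrable => // x _; rewrite /= mulrBl.
Qed.

Lemma field_dotC f h : field_dot f h = field_dot h f.
Proof. by apply: eq_bigr => i _; apply: eq_Rintegral => x _; rewrite mulrC. Qed.

(** K is symmetric by Fubini, and A is pointwise symmetric. *)
Lemma linear_op_symmetric f h r s : bfield f r -> bfield h s ->
  field_dot (linear_op f) h = field_dot f (linear_op h).
Proof.
move=> bf bh; rewrite [RHS]field_dotC.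
rewrite (field_dot_linear_op bf bh) (field_dot_linear_op bh bf) exchange_big/=.
apply: eq_bigr => j _; apply: eq_bigr => i _; congr (_ - _).
  by apply: eq_Rintegral => x _; rewrite bond_matrix_tr mulrAC.
rewrite (kernel_op_symmetric (sk i j) (bond_matrixC _ _ _ _ _ _ _) (bf j) (bh i)).
by apply: eq_Rintegral => x _; rewrite mulrC bond_matrix_tr.
Qed.

Lemma vdotE (f h f' h' : X -> X) r s : measurable_fun Omega f -> measurable_fun Omega h ->
  bfield f' r -> bfield h' s -> {ae leb, forall y, Omega y -> f y = f' y} ->
  (forall x, Omega x -> h x = h' x) -> (forall x, ~ Omega x -> h' x = 0) ->
  vdot Omega f h = field_dot f' h'.
Proof.
move=> mf mh bf bh ff' hh' h0; rewrite /vdot.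
transitivity (\int[leb]_(x in Omega) \sum_i (f' x i 0 * h' x i 0)).
  rewrite /Rintegral; congr fine; apply: ae_eq_integral => //.
  - by apply/measurable_EFinP; exact: measurable_edot.
  - apply/measurable_EFinP; apply: measurable_sum => i.
    have [m1 _] := bf i; have [m2 _] := bh i.
    by apply: measurable_funM; [exact: measurable_funS m1|exact: measurable_funS m2].
  - by apply: filterS ff' => y fy Oy; rewrite edotE fy// hh'.
rewrite -(Rintegral_mfrestr mO Ofin); last first.
  by move=> x nO; rewrite big1// => i _; rewrite h0// mxE mulr0.
by rewrite Rintegral_sum// => i; exact: bmeas_int (bmeasM (bf i) (bh i)).
Qed.

Lemma field_dot_sumr (I : Type) (t : seq I) (c : I -> R) (h : I -> X -> X) s f r :
  bfield f r -> (forall q, bfield (h q) (s q)) ->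
  field_dot f (fun x => \sum_(q <- t) c q *: h q x) = \sum_(q <- t) c q * field_dot f (h q).
Proof.
move=> bf bh; rewrite /field_dot; under [RHS]eq_bigr do rewrite mulr_sumr.
rewrite exchange_big/=; apply: eq_bigr => i _.
have iq q := bmeas_int (bmeasM (bf i) (bh q i)).
under eq_Rintegral.
  move=> x _; rewrite summxE mulr_sumr.
  under eq_bigr do rewrite mxE mulrCA.
  over.
rewrite Rintegral_sum; last by move=> q; exact: (integrableZl measurableT (c q) (iq q)).
by apply: eq_bigr => q _; rewrite RintegralZl//; exact: iq.
Qed.

End vector_operator.
(** * Rigid motions *)

Section rigid_motions.
Context {R : realType} {n : nat}.
Local Notation X := 'cV[R]_n.

(** Translations along the axes and rotations in the coordinate planes.  The
family spans but is redundant, since the rotation (a, b) is the opposite of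
(b, a); only spanning matters below. *)
Definition rigid_basis (q : 'I_n + 'I_n * 'I_n) : X -> X :=
  match q with
  | inl a => fun=> delta_mx a 0
  | inr ab => fun x => (delta_mx ab.1 ab.2 - delta_mx ab.2 ab.1) *m x
  end.

Lemma rigid_basis_rigid q : rigid_motion (rigid_basis q).
Proof.
case: q => [a|[a b]] /=.
  exists 0, (delta_mx a 0); split; first by rewrite trmx0 oppr0.
  by apply/funext => x; rewrite mul0mx add0r.
exists (delta_mx a b - delta_mx b a), 0; split.
  by rewrite linearB/= !trmx_delta opprB.
by apply/funext => x; rewrite addr0.
Qed.

Lemma rigid_span w : rigid_motion w ->
  exists c, w = fun x => \sum_q c q *: rigid_basis q x.
Proof.
move=> [Q [c [QT ->]]].
exists (fun q => match q with inl a => c a 0 | inr ab => 2^-1 * Q ab.1 ab.2 end).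
apply/funext => x; rewrite big_sumType/= [LHS]addrC; congr (_ + _).
  by rewrite {1}[c]matrix_sum_delta; apply: eq_bigr => a _; rewrite big_ord1.
have -> : Q *m x = (\sum_(ab : 'I_n * 'I_n) (2^-1 * Q ab.1 ab.2) *:
    (delta_mx ab.1 ab.2 - delta_mx ab.2 ab.1)) *m x.
  congr (_ *m _).
  under eq_bigr do rewrite scalerBr.
  rewrite sumrB -(pair_big xpredT xpredT (fun a b => (2^-1 * Q a b) *: delta_mx a b))/=.
  rewrite -(pair_big xpredT xpredT (fun a b => (2^-1 * Q a b) *: delta_mx b a))/=.
  rewrite [X in _ - X]exchange_big/=.
  rewrite -sumrB [LHS]matrix_sum_delta; apply: eq_bigr => a _.
  rewrite -sumrB; apply: eq_bigr => b _; rewrite -scalerBl.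
  have -> : Q b a = - Q a b by have /matrixP/(_ a b) := QT; rewrite !mxE.
  by congr (_ *: _); field.
by rewrite mulmx_suml; apply: eq_bigr => ab _; rewrite -scalemxAl.
Qed.

Lemma measurable_rigid (D : set X) w : measurable D -> rigid_motion w ->
  measurable_fun D w.
Proof.
move=> mD [Q [c [_ ->]]]; apply: measurable_cV => // i.
under eq_fun do rewrite !mxE.
apply: measurable_funD => //; apply: measurable_sum => j; apply: measurable_funM => //.
by apply: measurable_entry.
Qed.

Lemma edot_skew (Q : 'M[R]_n) (z : X) : Q^T = - Q -> edot (Q *m z) z = 0.
Proof.
move=> QT; have : edot (Q *m z) z = - edot (Q *m z) z.
  rewrite [in RHS]edotC /edot.
  have -> : (Q *m z)^T *m z = - (z^T *m (Q *m z)).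
    by rewrite trmx_mul QT mulmxN mulNmx mulmxA.
  by rewrite mxE.
by move=> h; lra.
Qed.

(** (Q z) . z = 0 when Q is skew. *)
Lemma strain_rigid w (x y : X) : rigid_motion w -> strain w y x = 0.
Proof.
move=> [Q [c [QT ->]]]; rewrite /strain /edir.
have -> : Q *m y + c - (Q *m x + c) = Q *m (y - x).
  by rewrite mulmxBr opprD addrACA subrr addr0.
have edotZ a b (p q : X) : edot (a *: p) (b *: q) = a * b * edot p q.
  by rewrite !edotE mulr_sumr; apply: eq_bigr => i _; rewrite !mxE; ring.
by rewrite edotZ edot_skew// mulr0.
Qed.

Lemma linearization_rigid (Omega : set X) eps J g u w x :
  rigid_motion w -> linearization Omega eps J g u w x = 0.
Proof.
move=> rw; apply/colP => i; rewrite !mxE.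
under eq_Rintegral do rewrite (strain_rigid _ _ rw) mulr0 scale0r mxE.
by rewrite Rintegral_mkcond; under eq_Rintegral do rewrite patchE if_same;
  rewrite Rintegral_cst// mul0r oppr0.
Qed.

End rigid_motions.

Section rigid_projection.
Context {R : realType} {n : nat} (Omega : set 'cV[R]_n).
Context (eps : R) (J g : R -> R) (u : 'cV[R]_n -> 'cV[R]_n).
Hypotheses (mO : measurable Omega) (Ofin : (lebesgue_cV n Omega < +oo)%E).
Hypothesis Obd : [bounded x | x in Omega].
Local Notation X := 'cV[R]_n.
Local Notation leb := (@lebesgue_cV R n).
Local Notation lebO := (mfrestr mO Ofin).
Local Notation k := (bond_matrix Omega eps J g u).
Local Notation linear_op := (linear_op eps J g u mO Ofin).
Local Notation field_dot := (field_dot mO Ofin).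
Variable m : R.
Hypothesis sk : forall i j, schur lebO (k i j) m.

Lemma bfield_rigid w : rigid_motion w -> exists r, bfield (zext Omega w) r.
Proof.
move=> rw; have [M M0 OM] := bounded_entry Obd; have [Q [c [_ wE]]] := rw.
exists (\sum_i (\sum_j `|Q i j| * M + `|c i 0|)) => i.
have pos a : 0 <= \sum_j `|Q a j| * M + `|c a 0|.
  by rewrite addr_ge0// sumr_ge0// => j _; rewrite mulr_ge0.
split.
  by apply: measurable_entry; apply: measurable_zext => //; exact: measurable_rigid.
move=> x; have [Ox|nO] := pselect (Omega x); last first.
  by rewrite zext_out// mxE normr0 sumr_ge0.
rewrite zext_in// wE !mxE; apply: (@le_trans _ _ (\sum_j `|Q i j| * M + `|c i 0|)).
  rewrite (le_trans (ler_normD _ _))// lerD2r (le_trans (ler_norm_sum _ _ _))//.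
  by apply: ler_sum => j _; rewrite normrM ler_wpM2l// OM.
by rewrite [leRHS](bigD1 i)//= lerDl sumr_ge0.
Qed.

Lemma linear_op_rigid w : rigid_motion w -> linear_op (zext Omega w) = fun=> 0.
Proof.
move=> rw; apply/funext => x; have [Ox|nO] := pselect (Omega x); last exact: linear_op_out.
have [r br] := bfield_rigid rw.
rewrite -(linearization_bounded sk br Ox).
rewrite -(linearization_rigid Omega eps J g u x rw).
apply/colP => i; rewrite [LHS]linearization_entry// [RHS]linearization_entry//.
congr (- _).
apply: eq_Rintegral => y /set_mem Oy; apply: eq_bigr => j _.
by rewrite (zext_in _ Ox) (zext_in _ Oy).
Qed.

(** L is symmetric and annihilates rigid motions. *)
Lemma linear_op_orthogonal f r w : bfield f r -> rigid_motion w ->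
  field_dot (linear_op f) (zext Omega w) = 0.
Proof.
move=> bf rw; have [s bs] := bfield_rigid rw.
rewrite (linear_op_symmetric sk bf bs) linear_op_rigid// /field_dot big1// => i _.
under eq_Rintegral do rewrite mxE mulr0.
by rewrite Rintegral_cst// mul0r.
Qed.

Definition rigid_ext q := zext Omega (rigid_basis (R := R) (n := n) q).

(** Not a projection, as the family is not orthonormal; it is symmetric and
nonnegative with the orthogonal of the rigid motions as its kernel. *)
Definition rigid_op (f : X -> X) x := \sum_q field_dot f (rigid_ext q) *: rigid_ext q x.

Lemma rigid_ext_bounded : exists s, forall q, bfield (rigid_ext q) (s q).
Proof.
have /choice[s bs] q := bfield_rigid (rigid_basis_rigid (R := R) q).
by exists s.
Qed.

Lemma bfield_comb (s : 'I_n + 'I_n * 'I_n -> R) c : (forall q, bfield (rigid_ext q) (s q)) ->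
  bfield (fun x => \sum_q c q *: rigid_ext q x) (\sum_q `|c q| * s q).
Proof.
move=> bs i; under eq_fun do rewrite summxE.
apply: bmeas_sum => q; under eq_fun do rewrite mxE.
exact: bmeasZ (bs q i).
Qed.

Lemma field_dot_rigid_ext_eq0 f r w : bfield f r ->
  (forall q, field_dot f (rigid_ext q) = 0) -> rigid_motion w ->
  field_dot f (zext Omega w) = 0.
Proof.
move=> bf f0 /rigid_span[c ->]; have [s bs] := rigid_ext_bounded.
have -> : zext Omega (fun x => \sum_q c q *: rigid_basis q x) =
    fun x => \sum_q c q *: rigid_ext q x.
  apply/funext => x; have [Ox|nO] := pselect (Omega x).
    by rewrite zext_in//; apply: eq_bigr => q _; rewrite /rigid_ext zext_in.
  by rewrite zext_out// big1// => q _; rewrite /rigid_ext zext_out// scaler0.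
by rewrite (field_dot_sumr _ _ _ _ bf bs) big1// => q _; rewrite f0 mulr0.
Qed.

(** <P f,P f> is a combination of the numbers <P f,p_q>, so P f = 0 almost
everywhere, and then <P f,f> = sum_q <f,p_q>^2 vanishes. *)
Lemma rigid_op_orthogonal f r : bfield f r ->
  (forall q, field_dot (rigid_op f) (rigid_ext q) = 0) ->
  forall q, field_dot f (rigid_ext q) = 0.
Proof.
move=> bf Pf0; have [s bs] := rigid_ext_bounded.
have bP := bfield_comb (fun q => field_dot f (rigid_ext q)) bs.
have : field_dot (rigid_op f) (rigid_op f) = 0.
  rewrite {2}/rigid_op (field_dot_sumr _ _ _ _ bP bs) big1// => q _; by rewrite Pf0 mulr0.
move=> PP0.
have sq0 i : \int[lebO]_x (rigid_op f x i 0 * rigid_op f x i 0) = 0.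
  apply/eqP; move/eqP: PP0; rewrite psumr_eq0; last first.
    by move=> j _; apply: Rintegral_ge0 => x _; rewrite -expr2 sqr_ge0.
  by move/allP => /(_ i (mem_index_enum i)).
have P0 i : {ae lebO, forall x, rigid_op f x i 0 = 0}.
  pose P2 x := rigid_op f x i 0 * rigid_op f x i 0.
  have bii := bmeasM (bP i) (bP i); have [mii _] := bii.
  have mEii : measurable_fun setT (EFin \o P2) by exact/measurable_EFinP.
  have : (\int[lebO]_x `|(EFin \o P2) x| = 0)%E.
    have -> : (fun x => `|(EFin \o P2) x|)%E = EFin \o P2.
      by apply/funext => x; rewrite /= ger0_norm// /P2 -expr2 sqr_ge0.
    rewrite -[LHS]fineK; last exact: (integrable_fin_num measurableT (bmeas_int mO Ofin bii)).
    by rewrite [fine _](sq0 i).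
  move/(ae_eq_integral_abs lebO measurableT mEii).
  apply: filterS => x /(_ I) /= [] /eqP; by rewrite mulf_eq0 orbb => /eqP.
have : \sum_q field_dot f (rigid_ext q) * field_dot f (rigid_ext q) = 0.
  rewrite -(field_dot_sumr _ _ _ _ bf bs) /field_dot big1// => i _.
  rewrite /Rintegral (ae_eq_integral (cst 0%E)) ?integral0//.
    by apply/measurable_EFinP; case: (bmeasM (bf i) (bP i)).
  by apply: filterS (P0 i) => x Px _ /=; rewrite -/(rigid_op f x) Px mulr0.
move=> s0 q; apply/eqP.
move/eqP: s0; rewrite psumr_eq0; last by move=> p _; rewrite -expr2 sqr_ge0.
by move/allP => /(_ q (mem_index_enum q)); rewrite mulf_eq0 orbb.
Qed.

End rigid_projection.
(** * Solving the regularized equation *)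

Section measurable_determinant.
Context {d} {T : measurableType d} {R : realType}.

Lemma measurable_det n (F : T -> 'M[R]_n) :
  (forall i j, measurable_fun setT (fun x => F x i j)) ->
  measurable_fun setT (fun x => \det (F x)).
Proof.
move=> mF; apply: measurable_sum => s; apply: measurable_funM => //.
by apply: measurable_prod => i _.
Qed.

Lemma measurable_adj n (F : T -> 'M[R]_n) i j :
  (forall i j, measurable_fun setT (fun x => F x i j)) ->
  measurable_fun setT (fun x => (\adj (F x)) i j).
Proof.
move=> mF; under eq_fun do rewrite mxE /cofactor.
apply: measurable_funM => //; apply: measurable_det => a b.
by under eq_fun do rewrite !mxE; exact: mF.
Qed.

Lemma measurable_funV (f : T -> R) : measurable_fun setT f ->
  measurable_fun setT (fun x => (f x)^-1).
Proof.
move=> mf; have -> : (fun x => (f x)^-1) = fun x => f x * (f x ^+ 2)^-1.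
  apply/funext => x; have [->|f0] := eqVneq (f x) 0; first by rewrite invr0 mul0r.
  by field.
apply: measurable_funM => //; apply: measurable_invr_ge0 => [|x]; last exact: sqr_ge0.
exact: measurable_funX.
Qed.

End measurable_determinant.

Lemma schur_le {d} {T : measurableType d} {R : realType}
    (mu : {finite_measure set T -> \bar R}) (H : T * T -> R) m m' :
  m <= m' -> schur mu H m -> schur mu H m'.
Proof.
move=> mm [m0 mH H1 H2]; split => //; first exact: le_trans mm.
- by move=> x; rewrite (le_trans (H1 x))// lee_fin.
- by move=> x; rewrite (le_trans (H2 x))// lee_fin.
Qed.

Lemma kernel_op_lmul {d} {T : measurableType d} {R : realType}
    (mu : {finite_measure set T -> \bar R}) (I : Type) (s : seq I)
    (a : I -> T -> R) (K : I -> T * T -> R) m f r x :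
  (forall l, schur mu (K l) m) -> bmeas f r ->
  kernel_op mu (fun p => \sum_(l <- s) a l p.1 * K l p) f x =
  \sum_(l <- s) a l x * kernel_op mu (K l) f x.
Proof.
move=> sK bf; have int l : mu.-integrable setT (EFin \o (fun y => K l (x, y) * f y)).
  by case: (schur_slice x (sK l) bf).
rewrite /kernel_op; under eq_Rintegral.
  move=> y _; rewrite /= mulr_suml.
  under eq_bigr do rewrite -mulrA.
  over.
rewrite Rintegral_sum; last by move=> l; exact: (integrableZl measurableT (a l x) (int l)).
by apply: eq_bigr => l _; rewrite RintegralZl//; exact: int.
Qed.

Section solve.
Context {R : realType} {n : nat} (Omega : set 'cV[R]_n.+1).
Context (eps : R) (J g : R -> R) (u : 'cV[R]_n.+1 -> 'cV[R]_n.+1).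
Hypotheses (mO : measurable Omega) (Ofin : (lebesgue_cV n.+1 Omega < +oo)%E).
Hypothesis Obd : [bounded x | x in Omega].
Hypotheses (mJ : measurable_fun setT J) (Jb : exists M, forall r, `|J r| <= M).
Hypotheses (mg : measurable_fun setT (derive1n 2 g))
  (gb : exists M, forall r, `|derive1n 2 g r| <= M).
Hypothesis mu : measurable_fun Omega u.
Hypothesis n2 : (2 <= n.+1)%N.
Local Notation X := 'cV[R]_n.+1.
Local Notation N := (n.+1%:R : R).
Local Notation leb := (@lebesgue_cV R n.+1).
Local Notation lebO := (mfrestr mO Ofin).
Local Notation k := (bond_matrix Omega eps J g u).
Local Notation A := (stability_tensor Omega eps J g u).
Local Notation linear_op := (linear_op eps J g u mO Ofin).
Local Notation rigid_op := (rigid_op mO Ofin).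
Local Notation field_dot := (field_dot mO Ofin).
Local Notation rigid_ext := (rigid_ext Omega).
Variable gamma : R.
Hypothesis gamma0 : gamma != 0.
Hypothesis stable : stability_sqr_ge Omega eps J g u gamma.

Let tensor x : 'M[R]_n.+1 := \matrix_(i, j) kernel_op lebO (k i j) (cst 1) x.

Let tensorE x : Omega x -> A x = tensor x.
Proof.
move=> Ox; apply/matrixP => i j; rewrite [RHS]mxE.
exact: stability_tensorE.
Qed.

Let tensor_sym x : (tensor x)^T = tensor x.
Proof. by apply/matrixP => i j; rewrite !mxE bond_matrix_tr. Qed.

(** A is symmetric, so the quadratic form of A^2 is |A eta|^2. *)
Let tensor_lower x (eta : X) : Omega x ->
  gamma ^+ 2 * enorm eta ^+ 2 <= enorm (tensor x *m eta) ^+ 2.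
Proof.
move=> Ox; have := stable eta Ox; rewrite (tensorE Ox) => /le_trans; apply.
by rewrite sqr_enorm /edot trmx_mul tensor_sym !mulmxA.
Qed.

Let tensor_unit x : Omega x -> tensor x \in unitmx.
Proof.
move=> Ox; rewrite unitmxE unitfE -det_tr; apply/negP => /det0P[v v0 vT].
case/eqP : v0; apply: trmx_inj; rewrite trmx0; apply: enorm0_eq0.
have := tensor_lower v^T Ox.
have -> : tensor x *m v^T = 0 by rewrite -[LHS]trmxK trmx_mul trmxK vT trmx0.
rewrite enorm0 expr0n/= => h; apply/eqP; rewrite -sqrf_eq0.
have g2 : 0 < gamma ^+ 2 by rewrite lt_neqAle sqr_ge0 eq_sym sqrf_eq0 gamma0.
by move: h; rewrite pmulr_rle0// => h; rewrite eq_le h sqr_ge0.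
Qed.

Definition tensor_inv i l x : R := \1_Omega x * invmx (tensor x) i l.

Let tensor_inv_bound i l x : `|tensor_inv i l x| <= `|gamma|^-1.
Proof.
have gi0 : 0 <= `|gamma|^-1 by rewrite invr_ge0.
have [Ox|nO] := pselect (Omega x); last first.
  by rewrite /tensor_inv indicE (memNset nO) mul0r normr0.
rewrite /tensor_inv indicE (mem_set Ox) mul1r.
pose eta : X := invmx (tensor x) *m delta_mx l 0.
have -> : invmx (tensor x) i l = eta i 0.
  by rewrite /eta -colE mxE.
apply: le_trans (le_entry_enorm _ _) _.
have := tensor_lower eta Ox; rewrite /eta mulmxA (mulmxV (tensor_unit Ox)) mul1mx -/eta.
have -> : enorm (delta_mx l 0 : X) ^+ 2 = 1.
  rewrite sqr_enorm edotE (bigD1 l)//= !mxE !eqxx mulr1 big1 ?addr0// => j jl.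
  by rewrite !mxE (negbTE jl) mul0r.
rewrite -exprMn -[leRHS](expr1n _ 2) -real_normK ?num_real// => h.
have : `|gamma * enorm eta| <= 1 by rewrite -(@ler_sqr R) ?nnegrE.
rewrite normrM (ger0_norm (enorm_ge0 _)) => {}h.
by rewrite -[leRHS]mulr1 ler_pdivlMl// normr_gt0.
Qed.

Variable m : R.
Hypothesis sk : forall i j, schur lebO (k i j) m.

Let b1 : bmeas (cst 1 : X -> R) 1.
Proof. by split=> // x; rewrite normr1. Qed.

Let bmeas_tensor_inv i l : bmeas (tensor_inv i l) `|gamma|^-1.
Proof.
split; last exact: tensor_inv_bound.
have -> : tensor_inv i l = fun x =>
    \1_Omega x * ((\det (tensor x))^-1 * (\adj (tensor x)) i l).
  apply/funext => x; rewrite /tensor_inv indicE.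
  have [Ox|nO] := pselect (Omega x); last by rewrite (memNset nO) mul0r mul0r.
  by rewrite /invmx (tensor_unit Ox) mxE.
have mt a b : measurable_fun setT (fun x => tensor x a b).
  under eq_fun do rewrite mxE.
  by case: (bmeas_kernel_op (sk a b) b1).
apply: measurable_funM; first exact: measurable_indic.
apply: measurable_funM; last exact: measurable_adj.
by apply: measurable_funV; exact: measurable_det.
Qed.

(** Multiplying L f + P f = b by A^-1 gives f - A^-1 (K - P) f = A^-1 b.  The
kernel of A^-1 (K - P) is cut at distance delta from the diagonal: the inner
part of A^-1 K satisfies the smallness hypothesis of [fredholm_system] for small
delta, and everything else is bounded. *)
Theorem bounded_solution :
  (forall f r, bfield f r -> (forall q, field_dot f (rigid_ext q) = 0) ->
    (forall x, linear_op f x = 0) ->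
    {ae lebO, forall x, f x = 0}) ->
  exists2 C, 0 <= C & forall b r, 0 <= r -> bfield b r ->
    (forall x, ~ Omega x -> b x = 0) -> (forall q, field_dot b (rigid_ext q) = 0) ->
    exists f, [/\ bfield f (C * r), forall x, ~ Omega x -> f x = 0,
      forall q, field_dot f (rigid_ext q) = 0 & forall x, linear_op f x = b x].
Proof.
move=> inj.
have [C0 C00 kC] := bond_matrix_bound Omega eps u Jb gb.
have [s bs] := rigid_ext_bounded mO Obd.
pose G := `|gamma|^-1.
have G0 : 0 < G by rewrite invr_gt0 normr_gt0.
have N0 : 0 < N by rewrite ltr0n.
pose Pk l j (p : X * X) := \sum_q rigid_ext q p.1 l 0 * rigid_ext q p.2 j 0.
have mPk l j : measurable_fun setT (Pk l j).
  apply: measurable_sum => q; have [ml _] := bs q l; have [mj _] := bs q j.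
  apply: measurable_funM.
    exact: (measurableT_comp ml).
  exact: (measurableT_comp mj).
have s0 q : 0 <= s q by case: (bs q ord0) => _ /(_ (0 : X)); exact: le_trans.
pose CP := \sum_q s q * s q.
have CP0 : 0 <= CP by apply: sumr_ge0 => q _; exact: mulr_ge0.
have PkC l j p : `|Pk l j p| <= CP.
  rewrite (le_trans (ler_norm_sum _ _ _))//; apply: ler_sum => q _.
  by rewrite normrM ler_pM//; [case: (bs q l)|case: (bs q j)].
have sPk l j := bounded_schur lebO (mPk l j) CP0 (PkC l j).
pose K l j p := k l j p + -1 * Pk l j p.
have sNPk l j : schur lebO (fun p => -1 * Pk l j p) (CP * fine (lebO setT)).
  apply: bounded_schur => //; first exact: measurable_funM.
  by move=> p; rewrite mulN1r normrN.
have sK l j : schur lebO (K l j) (m + CP * fine (lebO setT)) by exact: schurD.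
have kernel_opK l j f r x : bmeas f r ->
    kernel_op lebO (K l j) f x = kernel_op lebO (k l j) f x - kernel_op lebO (Pk l j) f x.
  move=> bf; rewrite (kernel_op_addr _ (sk l j) (sNPk l j) bf); congr (_ + _).
  have [int _] := schur_slice x (sPk l j) bf.
  rewrite -[RHS]mulN1r /kernel_op -RintegralZl//; apply: eq_Rintegral => y _.
  by rewrite mulrA.
have kernel_opPk f r x l : bfield f r ->
    \sum_j kernel_op lebO (Pk l j) (fun y => f y j 0) x = rigid_op f x l 0.
  move=> bf; rewrite /rigid_op summxE.
  under [RHS]eq_bigr do rewrite mxE mulr_suml.
  rewrite exchange_big/=; apply: eq_bigr => j _.
  have int q := bmeas_int mO Ofin (bmeasM (bf j) (bs q j)).
  rewrite /kernel_op; under eq_Rintegral.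
    move=> y _; rewrite /= mulr_suml.
    under eq_bigr => q _ do rewrite -mulrA [rigid_ext q y j 0 * _]mulrC.
    over.
  rewrite Rintegral_sum; last first.
    by move=> q; exact: (integrableZl measurableT (rigid_ext q x l 0) (int q)).
  by apply: eq_bigr => q _; rewrite (RintegralZl (rigid_ext q x l 0) measurableT (int q)) mulrC.
(* delta is chosen so that N G C0 2^(n+3) delta <= 1 / (4 N), see sH1 *)
pose D := 4 * N * (N * (G * C0) * 2 ^+ n.+3).
have NGC0 : 0 <= N * (G * C0).
  by apply: mulr_ge0; [exact: ltW|apply: mulr_ge0 => //; exact: ltW].
have D0 : 0 <= D.
  have h1 : 0 <= 4 * N by apply: mulr_ge0 => //; exact: ltW.
  by apply: mulr_ge0 => //; apply: mulr_ge0 => //; exact: exprn_ge0.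
pose delta := (1 + D)^-1.
have D1 : 0 < 1 + D by rewrite ltr_pwDl.
have delta0 : 0 < delta by rewrite invr_gt0.
have delta01 : 0 < delta <= 1.
  by rewrite delta0 /delta invf_le1// lerDl.
pose near (p : X * X) := enorm (p.2 - p.1) < delta.
have mnear (H : X * X -> R) (H' : X * X -> R) : measurable_fun setT H ->
    measurable_fun setT H' -> measurable_fun setT (fun p => if near p then H p else H' p).
  move=> mH mH'; apply: measurable_fun_ifT => //; apply: measurable_fun_ltr => //.
  by apply: measurable_enorm; exact: measurable_subcV.
have mk i j : measurable_fun setT (k i j) by case: (sk i j).
pose H1 i j p := \sum_l tensor_inv i l p.1 * (if near p then k l j p else 0).
pose H2 i j p := \sum_l tensor_inv i l p.1 *
  ((if near p then 0 else k l j p) + -1 * Pk l j p).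
have mti i l : measurable_fun setT (fun p : X * X => tensor_inv i l p.1).
  have [mt _] := bmeas_tensor_inv i l; exact: (measurableT_comp mt).
have sH1 i j : schur lebO (H1 i j) (4 * n.+1%:R)^-1.
  apply: (@schur_le _ _ _ _ _ (N * (G * C0) * (2 ^+ n.+3 * delta))).
    rewrite -[leRHS]mul1r ler_pdivlMr ?mulr_gt0//.
    have -> : N * (G * C0) * (2 ^+ n.+3 * delta) * (4 * N) = D * delta by rewrite /D; ring.
    by rewrite ler_pdivrMr// mul1r lerDr.
  apply: pole_schur => //.
  - by apply: measurable_sum => l; apply: measurable_funM => //; exact: mnear.
  - move=> x y xy; rewrite /H1 big1// => l _.
    by rewrite bond_matrix_supported// if_same mulr0.
  move=> p; rewrite (le_trans (ler_norm_sum _ _ _))//.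
  have -> : N * (G * C0) * near_pole p.1 delta p.2 =
      \sum_(l < n.+1) G * (C0 * near_pole p.1 delta p.2).
    by rewrite sumr_const card_ord -[RHS]mulr_natl !mulrA.
  apply: ler_sum => l _; rewrite normrM; apply: ler_pM => //.
  rewrite /near_pole /near; case: ifP => _; first exact: kC.
  by rewrite normr0 mulr0.
pose C2 := N * (G * (C0 * delta^-1 + CP)) + 1.
have C2p : 0 < C2.
  rewrite ltr_wpDl//; apply: mulr_ge0; first exact: ltW.
  apply: mulr_ge0; first exact: ltW.
  by apply: addr_ge0 => //; apply: mulr_ge0 => //; rewrite invr_ge0 ltW.
have mH2 i j : measurable_fun setT (H2 i j).
  apply: measurable_sum => l; apply: measurable_funM => //.
  by apply: measurable_funD; [exact: mnear|exact: measurable_funM].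
have H2C i j p : `|H2 i j p| <= C2.
  rewrite (le_trans (ler_norm_sum _ _ _))//.
  apply: (@le_trans _ _ (\sum_(l < n.+1) G * (C0 * delta^-1 + CP))).
    apply: ler_sum => l _; rewrite normrM; apply: ler_pM => //.
    rewrite (le_trans (ler_normD _ _))//; apply: lerD; last first.
      by rewrite mulN1r normrN.
    case: ifPn => [_|]; first by rewrite normr0 mulr_ge0// invr_ge0 ltW.
    rewrite /near -leNgt => dp; apply: le_trans (kC l j p) _.
    by rewrite ler_wpM2l// lef_pV2 ?posrE// (lt_le_trans delta0).
  by rewrite sumr_const card_ord -[leLHS]mulr_natl lerDl.
have H12 i j : (fun p => H1 i j p + H2 i j p) =
    fun p => \sum_l tensor_inv i l p.1 * K l j p.
  apply/funext => p; rewrite /H1 /H2 -big_split/=; apply: eq_bigr => l _.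
  by rewrite -mulrDr /K addrA; case: ifP => _; rewrite ?addr0 ?add0r.
pose vec (fs : 'I_n.+1 -> X -> R) : X -> X := fun x => \col_i fs i x.
have vecE fs i : (fun y => vec fs y i 0) = fs i by apply/funext => y; rewrite mxE.
have bfield_vec fs r : (forall i, bmeas (fs i) r) -> bfield (vec fs) r.
  by move=> bf i; rewrite vecE.
have key fs r i x : (forall i, bmeas (fs i) r) -> Omega x ->
    fs i x - \sum_j kernel_op lebO (fun p => H1 i j p + H2 i j p) (fs j) x =
    (invmx (tensor x) *m (linear_op (vec fs) x + rigid_op (vec fs) x)) i 0.
  move=> bf Ox; have bv := bfield_vec _ _ bf.
  have -> : linear_op (vec fs) x + rigid_op (vec fs) x = tensor x *m vec fs x -
      \col_l \sum_j kernel_op lebO (K l j) (fs j) x.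
    apply/colP => l; rewrite mxE linear_opE -(kernel_opPk _ _ _ _ bv) -big_split/= !mxE -sumrB.
    apply: eq_bigr => j _; rewrite !mxE vecE (kernel_opK _ _ _ _ _ (bf j)); ring.
  rewrite mulmxBr mulKmx ?tensor_unit// !mxE; congr (_ - _).
  under eq_bigr do rewrite H12 (kernel_op_lmul _ _ _ (sK ^~ _) (bf _)).
  rewrite exchange_big/=; apply: eq_bigr => l _; rewrite mxE mulr_sumr.
  by apply: eq_bigr => j _; rewrite /tensor_inv indicE (mem_set Ox) mul1r.
have out fs r i x : (forall i, bmeas (fs i) r) -> ~ Omega x ->
    \sum_j kernel_op lebO (fun p => H1 i j p + H2 i j p) (fs j) x = 0.
  move=> bf nO; rewrite big1// => j _.
  rewrite H12 (kernel_op_lmul _ _ _ (sK ^~ _) (bf _)) big1// => l _.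
  by rewrite /tensor_inv indicE (memNset nO) !mul0r.
have rigid_ext_out q x : ~ Omega x -> rigid_ext q x = 0 by exact: zext_out.
have rigid_op_out f x : ~ Omega x -> rigid_op f x = 0.
  by move=> nO; rewrite /rigid_op big1// => q _; rewrite rigid_ext_out// scaler0.
(* L f and b are orthogonal to the rigid motions, so P f = b - L f is too *)
have split f b r r' : bfield f r -> bfield b r' -> (forall q, field_dot b (rigid_ext q) = 0) ->
    (forall x, linear_op f x + rigid_op f x = b x) ->
    (forall q, field_dot f (rigid_ext q) = 0) /\ (forall x, linear_op f x = b x).
  move=> bf bb b0 eqf.
  have f0 : forall q, field_dot f (rigid_ext q) = 0.
    apply: (rigid_op_orthogonal Obd bf) => q.
    have -> : rigid_op f = fun x => \sum_(c <- [:: true; false])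
        (if c then 1 else -1) *: (if c then b else linear_op f) x.
      apply/funext => x; rewrite big_cons big_seq1/= scale1r scaleN1r.
      by rewrite -eqf addrAC subrr add0r.
    rewrite field_dotC (field_dot_sumr _ _ _ _ (bs q) (s := fun c => if c then r' else
      \sum_(j < n.+1) (m * 1 * r + m * r))); last first.
      by case=> //; exact: bfield_linear_op.
    rewrite big_cons big_seq1/= ![field_dot (rigid_ext q) _]field_dotC b0.
    rewrite (linear_op_orthogonal Obd sk bf (rigid_basis_rigid q)); ring.
  split => // x; rewrite -eqf /rigid_op big1 ?addr0// => q _.
  by rewrite f0 scale0r.
have [|B B0 solve] := @fredholm_system _ X R lebO n H1 H2 C2 C2p sH1 mH2 H2C.
  move=> fs r bf fE.
  have bv := bfield_vec _ _ bf.
  have b0 : bfield (fun=> 0 : X) 0.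
    by move=> i; under eq_fun do rewrite mxE; split=> // x; rewrite normr0.
  have field_dot0 q : field_dot (fun=> 0) (rigid_ext q) = 0.
    rewrite /field_dot big1// => i _; under eq_Rintegral do rewrite mxE mul0r.
    by rewrite Rintegral_cst// mul0r.
  have [|f0 L0] := split _ _ _ _ bv b0 field_dot0.
    move=> x; have [Ox|nO] := pselect (Omega x); last first.
      by rewrite linear_op_out// rigid_op_out// addr0.
    have : invmx (tensor x) *m (linear_op (vec fs) x + rigid_op (vec fs) x) = 0.
      by apply/colP => i; rewrite -(key _ _ _ _ bf Ox) -fE subrr mxE.
    by move/(congr1 (mulmx (tensor x))); rewrite mulKVmx ?tensor_unit// mulmx0.
  have := inj _ _ bv f0 L0 => ae0 i.
  by apply: filterS ae0 => x /colP/(_ i); rewrite !mxE.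
exists (B * (N * G)); first by rewrite mulr_ge0// mulr_ge0// ltW.
move=> b r r0 bb bout b0.
pose bs' i x := \sum_l tensor_inv i l x * b x l 0.
have bbs i : bmeas (bs' i) (N * G * r).
  have -> : N * G * r = \sum_(l < n.+1) G * r.
    by rewrite sumr_const card_ord -[RHS]mulr_natl mulrA.
  by apply: bmeas_sum => l; exact: bmeasM (bmeas_tensor_inv i l) (bb l).
have NGr0 : 0 <= N * G * r by rewrite mulr_ge0// mulr_ge0// ltW.
have [fs [bf fE]] := solve bs' _ NGr0 bbs.
have fout x : ~ Omega x -> vec fs x = 0.
  move=> nO; apply/colP => i; rewrite !mxE.
  have := fE i x; rewrite (out _ _ _ _ bf nO) subr0 => ->.
  by rewrite /bs' big1// => l _; rewrite /tensor_inv indicE (memNset nO) !mul0r.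
have [|f0 Lb] := split _ _ _ _ (bfield_vec _ _ bf) bb b0.
  move=> x; have [Ox|nO] := pselect (Omega x); last first.
    by rewrite linear_op_out// rigid_op_out// addr0 bout.
  have : invmx (tensor x) *m (linear_op (vec fs) x + rigid_op (vec fs) x) =
      invmx (tensor x) *m b x.
    apply/colP => i; rewrite -(key _ _ _ _ bf Ox) fE mxE; apply: eq_bigr => l _.
    by rewrite /tensor_inv indicE (mem_set Ox) mul1r.
  by move/(congr1 (mulmx (tensor x))); rewrite !mulKVmx ?tensor_unit.
exists (vec fs); split => //.
by rewrite -mulrA; exact: bfield_vec.
Qed.

End solve.
(** * The space calV and the inverse *)

Lemma bounded_fun_ex {R : realType} (f : R -> R) :
  [bounded f r | r in setT] -> exists M, forall r, `|f r| <= M.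
Proof.
move=> [M [Mr fM]]; exists (`|M| + 1) => r; apply: fM => //.
by rewrite ltr_pwDr// ler_norm.
Qed.

Lemma derivable_measurable {R : realType} (f : R -> R) :
  (forall x, derivable f x 1) -> measurable_fun setT f.
Proof.
move=> df; apply: continuous_measurable_fun => x.
by apply: differentiable_continuous; apply/derivable1_diffP; exact: df.
Qed.

Section vector_fields.
Context {R : realType} {n : nat} (Omega : set 'cV[R]_n).
Hypotheses (mO : measurable Omega) (Ofin : (lebesgue_cV n Omega < +oo)%E).
Hypothesis Obd : [bounded x | x in Omega].
Local Notation X := 'cV[R]_n.
Local Notation leb := (@lebesgue_cV R n).
Local Notation lebO := (mfrestr mO Ofin).
Local Notation field_dot := (field_dot mO Ofin).

Lemma vLnorm_oo_leP (f : X -> X) r : 0 <= r ->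
  (vLnorm Omega +oo%E f <= r%:E)%E <->
  {ae leb, forall x, Omega x -> enorm (f x) <= r}.
Proof.
move=> r0; rewrite /vLnorm unlock /= lebesgue_setT_gt0.
split=> [/ess_supP|] h.
  apply: filterS h => x /= + Ox; rewrite patchE mem_set//= lee_fin.
  by rewrite ger0_norm ?enorm_ge0.
apply/ess_supP; apply: filterS h => x /= h; rewrite lee_fin patchE.
case: ifPn => [/set_mem Ox|_]; last by rewrite normr0.
by rewrite ger0_norm ?enorm_ge0//; exact: h.
Qed.

Lemma vLnorm_ge0 p (f : X -> X) : (0 <= vLnorm Omega p f)%E.
Proof. exact: Lnorm_ge0. Qed.

(** An essentially bounded field is truncated at its essential bound. *)
Lemma bounded_representative (f : X -> X) r : 0 <= r -> measurable_fun Omega f ->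
  {ae leb, forall x, Omega x -> enorm (f x) <= r} ->
  exists f', [/\ bfield f' r, forall x, ~ Omega x -> f' x = 0 &
    {ae leb, forall x, Omega x -> f x = f' x}].
Proof.
move=> r0 mf fr; pose v := zext Omega f.
have mv : measurable_fun setT v by exact: measurable_zext.
pose f' x := if enorm (v x) <= r then v x else 0.
exists f'; split.
- move=> i; split.
    apply: measurable_entry; apply: measurable_fun_ifT => //.
    by apply: measurable_fun_ler => //; exact: measurable_enorm.
  move=> x; rewrite /f'; case: ifP => [vr|_]; last by rewrite mxE normr0.
  exact: le_trans (le_entry_enorm _ _) vr.
- by move=> x nO; rewrite /f' /v zext_out// if_same.
- by apply: filterS fr => x fr Ox; rewrite /f' /v zext_in// fr.
Qed.

Lemma ae_enorm_le (f f' : X -> X) r : bfield f' r -> 0 <= r ->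
  {ae leb, forall x, Omega x -> f x = f' x} ->
  {ae leb, forall x, Omega x -> enorm (f x) <= n%:R * r}.
Proof.
move=> bf r0; apply: filterS => x fx Ox; rewrite fx//.
by apply: enorm_le => // i; case: (bf i).
Qed.

Lemma calV_intro (f f' : X -> X) r : 0 <= r -> measurable_fun Omega f -> bfield f' r ->
  {ae leb, forall x, Omega x -> f x = f' x} ->
  (forall w, rigid_motion w -> field_dot f' (zext Omega w) = 0) -> calV Omega f.
Proof.
move=> r0 mf bf ff' orth; split; first split => //.
  have nr0 : 0 <= n%:R * r by exact: mulr_ge0.
  have := (vLnorm_oo_leP f nr0).2 (ae_enorm_le bf r0 ff').
  by move=> /le_lt_trans; apply; rewrite ltry.
move=> w rw; have [s bs] := bfield_rigid mO Obd rw.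
rewrite (vdotE mO Ofin (f' := f') (h' := zext Omega w) mf _ bf bs)//.
- exact: orth.
- exact: measurable_rigid.
- by move=> x Ox; rewrite zext_in.
- by move=> x nO; rewrite zext_out.
Qed.

Lemma calV_elim (f : X -> X) : calV Omega f -> let r := fine (vLnorm Omega +oo%E f) in
  [/\ 0 <= r, vLnorm Omega +oo%E f = r%:E, measurable_fun Omega f & exists f',
    [/\ bfield f' r, forall x, ~ Omega x -> f' x = 0,
        {ae leb, forall x, Omega x -> f x = f' x} &
        forall w, rigid_motion w -> field_dot f' (zext Omega w) = 0]].
Proof.
move=> [[mf foo] orth] r.
have rE : vLnorm Omega +oo%E f = r%:E by rewrite fineK// ge0_fin_numE// vLnorm_ge0.
have r0 : 0 <= r by rewrite fine_ge0// vLnorm_ge0.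
have fr : {ae leb, forall x, Omega x -> enorm (f x) <= r}.
  by apply/(vLnorm_oo_leP f r0); rewrite rE.
split => //; have [f' [bf f0 ff']] := bounded_representative r0 mf fr.
exists f'; split => // w rw; have [s bs] := bfield_rigid mO Obd rw.
rewrite -(orth w rw) (vdotE mO Ofin (f' := f') (h' := zext Omega w) mf _ bf bs)//.
- exact: measurable_rigid.
- by move=> x Ox; rewrite zext_in.
- by move=> x nO; rewrite zext_out.
Qed.

Lemma calV_lin a (f h : X -> X) : calV Omega f -> calV Omega h -> calV Omega (a *: f + h).
Proof.
move=> /calV_elim[rf0 _ mf [f' [bf f0 ff' of']]] /calV_elim[rh0 _ mh [h' [bh h0 hh' oh']]].
set r := fine _ in rf0 bf; set s := fine _ in rh0 bh.
pose c (b : bool) : R := if b then a else 1.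
pose F (b : bool) : X -> X := if b then f' else h'.
pose B (b : bool) : R := if b then r else s.
have bF b : bfield (F b) (B b) by case: b.
have sumE x : \sum_(b <- [:: true; false]) c b *: F b x = a *: f' x + h' x.
  by rewrite big_cons big_seq1 /c /F scale1r.
apply: (@calV_intro _ (fun x => \sum_(b <- [:: true; false]) c b *: F b x)
   (`|a| * r + s)).
- by rewrite addr_ge0// mulr_ge0.
- apply: measurable_cV => // i; under eq_fun do rewrite !mxE.
  by apply: measurable_funD; [apply: measurable_funM => //|]; exact: measurable_entry.
- move=> i; under eq_fun do rewrite sumE !mxE.
  by apply: bmeasD; [exact: bmeasZ|exact: bh].
- apply: filterS2 ff' hh' => x fx hx Ox.
  by rewrite sumE -fx// -hx.
- move=> w rw; have [t bt] := bfield_rigid mO Obd rw.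
  rewrite field_dotC (field_dot_sumr _ _ _ _ bt bF) big_cons big_seq1 /F.
  by rewrite ![field_dot (zext _ _) _]field_dotC of'// oh'// !mulr0 addr0.
Qed.

Lemma calV_closure2_of (f : X -> X) : calV Omega f -> calV_closure2 Omega f.
Proof.
move=> Vf; have [r0 rE mf _] := calV_elim Vf; set r := fine _ in r0 rE.
split; last first.
  move=> delta d0; exists f => //; rewrite subrr /vLnorm.
  have -> : (EFin \o ((@enorm R n \o (0 : X -> X)) \_ Omega))%FUN = cst 0%E.
    by apply/funext => x /=; rewrite patchE; case: ifP => //; rewrite /= enorm0.
  by rewrite Lnorm0 ?lte_fin.
split=> //; rewrite /vLnorm unlock; apply: poweR_lty.
have fr : {ae leb, forall x, Omega x -> enorm (f x) <= r}.
  by apply/(vLnorm_oo_leP f r0); rewrite rE.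
have mh : measurable_fun setT ((@enorm R n \o f) \_ Omega).
  apply/(measurable_restrictT _ mO); apply: measurableT_comp => //.
  by apply: measurable_enorm.
pose h := (@enorm R n \o f) \_ Omega.
have hE x : (`|(EFin \o h) x| `^ 2 = (`|h x| ^+ 2)%:E)%E.
  by rewrite /= powR_mulrn.
under eq_integral do rewrite hE.
apply: (@le_lt_trans _ _ (\int[leb]_x (r ^+ 2 * \1_Omega x)%:E)%E).
  apply: ae_ge0_le_integral => //.
  - by apply/measurable_EFinP; apply: measurable_funX; exact: measurableT_comp.
  - by move=> x _; rewrite lee_fin mulr_ge0 ?sqr_ge0.
  - by apply/measurable_EFinP; apply: measurable_funM => //; exact: measurable_indic.
  apply: filterS fr => x fr _; rewrite lee_fin /h patchE indicE.
  have [Ox|nO] := pselect (Omega x); last first.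
    by rewrite (memNset nO) normr0 expr0n mulr0.
  rewrite (mem_set Ox) mulr1 real_normK ?num_real//.
  by rewrite ler_sqr ?nnegrE ?enorm_ge0 ?fr.
under eq_integral do rewrite EFinM.
rewrite ge0_integralZl_EFin ?sqr_ge0//; last first.
  by apply/measurable_EFinP; exact: measurable_indic.
rewrite integral_indic// setIT lte_mul_pinfty//.
by rewrite lee_fin sqr_ge0.
Qed.

End vector_fields.
Section bounded_inverse.
Context {R : realType} {n : nat} (Omega : set 'cV[R]_n.+1).
Context (eps : R) (J g : R -> R) (u : 'cV[R]_n.+1 -> 'cV[R]_n.+1).
Local Notation X := 'cV[R]_n.+1.
Local Notation L := (linearization Omega eps J g u).
Local Notation leb := (@lebesgue_cV R n.+1).

(** L maps calV to itself, since L f is orthogonal to the rigid motions.  The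
inverse S b is any solution provided by [bounded_solution] for a bounded
representative of b; injectivity of L on calV makes S linear and a left inverse
up to null sets. *)
Theorem linearization_bounded_inverse : (2 <= n.+1)%N ->
  open Omega -> [bounded x | x in Omega] -> influence_function J -> potential g ->
  calV Omega u ->
  bounded_linear_map Omega 2%:E (calV_closure2 Omega) L ->
  trivial_kernel Omega (calV_closure2 Omega) L ->
  (exists2 gamma : R, gamma != 0 & stability_sqr_ge Omega eps J g u gamma) ->
  has_bounded_inverse Omega +oo%E (calV Omega) L.
Proof.
move=> n2 oO Obd [mJ Jb _ _] [[dg _] gb _ _ _] [[mu _] _] [Lmap Llin _] Lker
  [gamma gamma0 stable].
have mO := open_measurable_cV oO.
have Ofin := bounded_lebesgue_lty mO Obd.
have {}Jb := bounded_fun_ex Jb.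
have {}gb := bounded_fun_ex (gb 2%N isT).
have mg : measurable_fun setT (derive1n 2 g).
  by apply: derivable_measurable => x; exact: dg.
have [m sk] := bond_matrix_schur eps mO Ofin mJ Jb mg gb mu n2.
have clos f := calV_closure2_of mO Ofin Obd (f := f).
have mL f : calV Omega f -> measurable_fun Omega (L f).
  by move=> /clos/Lmap[[]].
have LV f : calV Omega f -> calV Omega (L f).
  move=> Vf; have [r0 _ mf [f' [bf f0 ff' orth]]] := calV_elim mO Ofin Obd Vf.
  have [m0 _ _ _] := sk ord0 ord0.
  have bLf := bfield_linear_op sk bf.
  have s0 : 0 <= \sum_(j < n.+1) (m * 1 * fine (vLnorm Omega +oo%E f) +
      m * fine (vLnorm Omega +oo%E f)).
    by case: (bLf ord0) => _ /(_ (0 : X)); exact: le_trans.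
  apply: (calV_intro Obd s0 (mL f Vf) bLf).
  - apply: filterS (ff') => x fx Ox.
    rewrite (linearization_ae sk mf bf ff' Ox).
    by rewrite fx// subrr mulmx0 addr0.
  - by move=> w rw; exact: (linear_op_orthogonal Obd sk bf rw).
have ker0 f : calV Omega f -> ae_eq_on Omega (L f) 0 -> ae_eq_on Omega f 0.
  by move=> Vf; apply: Lker; exact: clos.
have [|C C0 solve] := bounded_solution Obd Jb gb n2 gamma0 stable sk.
  move=> f r bf f0 Lf0.
  have r0 : 0 <= r by case: (bf ord0) => _ /(_ (0 : X)); exact: le_trans.
  have mf : measurable_fun Omega f.
    apply: measurable_cV => // i; have [mfi _] := bf i; exact: measurable_funS mfi.
  have Vf : calV Omega f.
    apply: (calV_intro Obd r0 mf bf); first exact: aeW.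
    by move=> w rw; exact: (field_dot_rigid_ext_eq0 Obd bf f0 rw).
  apply: ae_mfrestr => //; apply: ker0 => //.
  by apply: aeW => x Ox; rewrite (linearization_bounded sk bf Ox) Lf0.
split => //.
have /choice[S SP] (b : X -> X) : exists f, calV Omega b -> [/\ calV Omega f,
    ae_eq_on Omega (L f) b &
    (vLnorm Omega +oo%E f <= (n.+1%:R * C)%:E * vLnorm Omega +oo%E b)%E].
  have [Vb|nV] := pselect (calV Omega b); last by exists b.
  have [r0 rE mb [b' [bb b0 bb' orth]]] := calV_elim mO Ofin Obd Vb.
  have orthq q : field_dot mO Ofin b' (rigid_ext Omega q) = 0.
    by apply: orth; exact: rigid_basis_rigid.
  have [f [bf fout f0 Lf]] := solve b' _ r0 bb b0 orthq.
  have Cr0 : 0 <= C * fine (vLnorm Omega +oo%E b) by exact: mulr_ge0.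
  have mf : measurable_fun Omega f.
    apply: measurable_cV => // i; have [mfi _] := bf i; exact: measurable_funS mfi.
  exists f => _; split.
  - apply: (calV_intro Obd Cr0 mf bf); first exact: aeW.
    by move=> w rw; exact: (field_dot_rigid_ext_eq0 Obd bf f0 rw).
  - apply: filterS bb' => x bx Ox.
    by rewrite (linearization_bounded sk bf Ox) Lf bx.
  - rewrite rE -EFinM -mulrA; have NCr0 := mulr_ge0 (ler0n R n.+1) Cr0.
    apply/(vLnorm_oo_leP Omega f NCr0).
    by apply: (ae_enorm_le bf Cr0); exact: aeW.
have Llin2 a f h : calV Omega f -> calV Omega h ->
    ae_eq_on Omega (L (a *: f + h)) (a *: L f + L h).
  by move=> Vf Vh; apply: Llin; exact: clos.
have uniq f h : calV Omega f -> calV Omega h -> ae_eq_on Omega (L f) (L h) ->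
    ae_eq_on Omega f h.
  move=> Vf Vh fh.
  have Vd := calV_lin mO Ofin Obd (-1) Vh Vf.
  have : ae_eq_on Omega (-1 *: h + f) 0.
    apply: ker0 => //; apply: filterS2 (Llin2 (-1) _ _ Vh Vf) fh => x Lx fhx Ox.
    apply: (etrans (Lx Ox)).
    by rewrite -[LHS]/(-1 *: L h x + L f x) (fhx Ox) scaleN1r addNr.
  apply: filterS => x dx Ox; have := dx Ox.
  move=> h0; have {}h0 : -1 *: h x + f x = 0 by exact: h0.
  by apply/eqP; rewrite -subr_eq0 addrC -scaleN1r h0.
exists S; last first.
  move=> f Vf; have [VS LS _] := SP f Vf; split => //.
  have [VSL LSL _] := SP _ (LV _ Vf).
  exact: uniq.
split.
- by move=> f /SP[].
- move=> a f h Vf Vh; have Vafh := calV_lin mO Ofin Obd a Vf Vh.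
  have [VS LS _] := SP _ Vafh; have [VSf LSf _] := SP _ Vf; have [VSh LSh _] := SP _ Vh.
  apply: uniq => //; first exact: calV_lin.
  apply: filterS3 (filterI LSf LSh) LS (Llin2 a _ _ VSf VSh) => x [hf hh] h1 h2 Ox.
  rewrite h1// h2//; transitivity (a *: f x + h x) => //.
  by rewrite -(hf Ox) -(hh Ox).
- by exists (n.+1%:R * C) => f /SP[].
Qed.

End bounded_inverse.
Theorem theorem8 (R : realType) (d : nat) (d23 : d = 2%N \/ d = 3%N)
    (Omega : set 'cV[R]_d)
    (Omega_open : open Omega) (Omega_connected : connected Omega)
    (Omega_bounded : [bounded x | x in Omega])
    (Omega_cone : interior_cone_condition Omega)
    (eps : R) (eps_gt0 : 0 < eps)
    (J : R -> R) (J_influence : influence_function J)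
    (g : R -> R) (g_potential : potential g)
    (u : 'cV[R]_d -> 'cV[R]_d) (u_calV : calV Omega u)
    (L_bounded : bounded_linear_map Omega 2%:E (calV_closure2 Omega)
                   (linearization Omega eps J g u))
    (L_symmetric : symmetric_map Omega (calV_closure2 Omega)
                     (linearization Omega eps J g u))
    (L_kernel : trivial_kernel Omega (calV_closure2 Omega)
                  (linearization Omega eps J g u))
    (A_stable : exists2 gamma : R, gamma != 0 &
                  stability_sqr_ge Omega eps J g u gamma) :
  has_bounded_inverse Omega +oo%E (calV Omega) (linearization Omega eps J g u).
Proof.
case: d23 => d_eq; subst d;
  exact: (linearization_bounded_inverse _ Omega_open Omega_bounded J_influence
    g_potential u_calV L_bounded L_kernel A_stable).
Qed.
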